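(* Assume the regularity, monotonicity, noise (with fixed integer $p\ge 1$) and kernel assumptions listed in the context, and let $(\theta_k)_{k\ge 0}$ be the iterates of the constant-stepsize stochastic approximation recursion with stepsize $\alpha>0$ described there. Let $n\in\{1,2,\dots,p\}$ be fixed. Then there exist constants $C_{n,1},C_{n,2}>0$ and $\alpha_n\in(0,1)$ such that for all $\alpha\in(0,\alpha_n)$ and all $k\ge 0$, $$\mathbb{E}\left[\|\theta_k-\theta^*\|^{2n}\right]\le (1-n\alpha\mu)^k\,C_{n,1}\,\mathbb{E}\left[\|\theta_0-\theta^*\|^{2n}\right]+C_{n,2}\,\alpha^n .$$
   Context: Setting. $\|\cdot\|$ is the Euclidean norm (and the induced operator norm for derivatives). $(\mathbb{X},d_{\mathbb{X}})$ is a metric space. For each $\theta\in\mathbb{R}^d$, $P_\theta$ is a Markov kernel on $\mathbb{X}$ with unique invariant distribution $\pi_\theta$. $g:\mathbb{R}^d\times\mathbb{X}\to\mathbb{R}^d$ is measurable, $\bar g(\theta):=\int g(\theta,x)\,\pi_\theta(dx)$ is the mean field, and $\theta^*$ denotes the root $\bar g(\theta^* )=0$ (unique under the monotonicity assumption below). Given a stepsize $\alpha>0$ and an initial pair $(\theta_0,X_0)$, the recursion is $$\theta_{k+1}=\theta_k+\alpha\bigl(g(\theta_k,X_{k+1})+\xi_{k+1}(\theta_k)\bigr),\qquad k\ge0,$$ where $\mathfrak F_k:=\sigma\{\theta_0,X_0,(\theta_t,X_t,\xi_t):1\le t\le k\}$, the conditional law of $X_{k+1}$ given $\mathfrak F_k$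 is $P_{\theta_k}(X_k,\cdot)$, and $(\xi_k)_{k\ge1}$ are random fields $\theta\mapsto\xi_k(\theta)\in\mathbb{R}^d$. The constants in the claim do not depend on $\alpha$ or $k$. $W_2$ is the Wasserstein 2-distance on probability measures on $\mathbb{X}$ with cost $d_{\mathbb{X}}$. Regularity assumption. For each $x\in\mathbb{X}$, $\theta\mapsto g(\theta,x)$ is three times continuously differentiable ($g^{(i)}$ denotes the $i$-th derivative in $\theta$, $g^{(0)}=g$). There is $L_1>0$ such that for all $x,x'\in\mathbb{X}$, $\theta,\theta'\in\mathbb{R}^d$, $i\in\{0,1,2\}$: $\|g^{(i+1)}(\theta,x)\|\le L_1$; $\|g^{(i)}(\theta,x)-g^{(i)}(\theta',x')\|\le L_1(\|\theta-\theta'\|+d_{\mathbb{X}}(x,x'))$; $\|\bar g(\theta)-\bar g(\theta')\|\le L_1\|\theta-\theta'\|$; and $\|g(\theta,x)\|\le L_1(1+\|\theta-\theta^*\|)$. Monotonicity assumption. There is $\mu>0$ such that $\langle\theta-\theta',\bar g(\theta)-\bar g(\theta')\rangle\le-\mu\|\theta-\theta'\|^2$ for all $\theta,\theta'\in\mathbb{R}^d$. Noise assumption (for a fixed integer $p\ge1$). For every $\theta$, $\xi_{k+1}(\theta)$ is $\mathfrak F_{k+1}$-measurable, $\mathbb{E}[\xi_{k+1}(\theta)\mid\mathfrak F_k]=0$ (also understood with $\theta=\theta_k$), and $(\xi_k)$ are i.i.d. random fields. There is $L_{2,p}>0$ with $\mathbb{E}[\|\xi_{k+1}(\theta_k)\|^{2p}\mid\mathfrak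 F_k]\le L_{2,p}(1+\|\theta_k-\theta^*\|^{2p})$ almost surely, and $L_\xi\ge0$ with $\mathbb{E}[\|\xi_k(\theta)-\xi_k(\theta')\|^2]\le L_\xi^2\|\theta-\theta'\|^2$ for all $\theta,\theta'$. Kernel assumption. $\mathbb{X}$ is compact and there are $\rho\in(0,1]$, $L_P>0$ such that $W_2(P_\theta(x,\cdot),P_\theta(x',\cdot))\le(1-\rho)\,d_{\mathbb{X}}(x,x')$ and $W_2(P_\theta(x,\cdot),P_{\theta'}(x,\cdot))\le L_P\|\theta-\theta'\|$ for all $\theta,\theta'\in\mathbb{R}^d$, $x,x'\in\mathbb{X}$. *)

(* Defs.v *)
From HB Require Import structures.
From mathcomp Require Import all_boot all_order all_algebra.
From mathcomp Require Import all_classical all_reals all_analysis measurable_realfun.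

Set Implicit Arguments.
Unset Strict Implicit.
Unset Printing Implicit Defensive.
Import Order.TTheory GRing.Theory Num.Theory.
Import numFieldNormedType.Exports.
Local Open Scope classical_set_scope.
Local Open Scope ring_scope.

(* A metric space with a distinguished point: [measurableType] requires one.
   A space carrying a probability measure is nonempty, so nothing is lost. *)
#[short(type="pointedMetricType")]
HB.structure Definition PointedMetric (K : numDomainType) :=
  { M of Metric K M & isPointed M }.

(* [T] with its Borel sigma-algebra. *)
Notation borel T := (g_sigma_algebraType (@open T)).

Section euclidean.
Context {R : realType} {d : nat}.
Local Notation V := 'rV[R]_d.

Definition edot (u v : V) : R := \sum_(i < d) u 0 i * v 0 i.

(* The norm [`|v|] of the library on row vectors is the max norm; it induces
   the same topology, hence the same notion of derivative. *)
Definition enorm (v : V) : R := Num.sqrt (edot v v).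

(* The [(size vs)]-th derivative of [f], as the multilinear map
   [vs |-> f^(i)(theta)[v_1, ..., v_i]]. *)
Fixpoint iter_diff (f : V -> V) (vs : seq V) (theta : V) : V :=
  if vs is v :: vs' then iter_diff (fun t => 'd f t v) vs' theta
  else f theta.

Definition derivn (f : V -> V) (i : nat) (theta : V) (vs : i.-tuple V) : V :=
  iter_diff f vs theta.

(* The domain being finite-dimensional, continuity of [t |-> 'd f t] in operator
   norm is continuity of [t |-> 'd f t v] for each [v]. *)
Fixpoint Cn (n : nat) (f : V -> V) : Prop :=
  if n is n'.+1 then
    (forall t, differentiable f t) /\ (forall v, Cn n' (fun t => 'd f t v))
  else continuous f.

(* Operator norm induced by [enorm] on [i]-linear maps; for [i = 0] it is the
   Euclidean norm of the value. *)
Definition opnorm (i : nat) (T : i.-tuple V -> V) : \bar R :=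
  ereal_sup [set (enorm (T vs))%:E |
    vs in [set vs : i.-tuple V | forall j, enorm (tnth vs j) <= 1]].

End euclidean.
Arguments derivn {R d} f i theta vs.

Section wasserstein.
Context {R : realType} {X : pointedMetricType R}.
Local Open Scope ereal_scope.

Definition coupling (mu nu : {measure set (borel X) -> \bar R})
    (gamma : probability (borel X * borel X)%type R) : Prop :=
  forall A : set (borel X), measurable A ->
    gamma (A `*` setT) = mu A /\ gamma (setT `*` A) = nu A.

Definition W2 (mu nu : {measure set (borel X) -> \bar R}) : \bar R :=
  (ereal_inf [set \int[gamma]_z ((mdist (z.1 : X) (z.2 : X)) ^+ 2)%:E |
    gamma in coupling mu nu]) `^ 2^-1.

End wasserstein.

Section conditioning.
Context {R : realType} {dO : measure_display} {Omega : measurableType dO}.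
Variable P : probability Omega R.
Local Open Scope ereal_scope.

(* [Z] is a version of E[Y | G], for a sub-sigma-algebra [G] and [Y] nonnegative
   or integrable. *)
Definition is_cond_exp (G : set (set Omega)) (Y Z : Omega -> \bar R) : Prop :=
  [/\ measurable_fun [set: Omega] Y,
      (forall w, 0 <= Y w) \/ P.-integrable [set: Omega] Y,
      measurable_fun [set: g_sigma_algebraType G] (Z : g_sigma_algebraType G -> _)
    & forall B, G B -> \int[P]_(w in B) Z w = \int[P]_(w in B) Y w].

(* Regular conditional law of [Y] given [G]. *)
Definition is_cond_law (T : pointedMetricType R) (G : set (set Omega))
    (Y : Omega -> T) (Q : Omega -> set (borel T) -> \bar R) : Prop :=
  forall A : set (borel T), measurable A ->
    is_cond_exp G (fun w => (\1_(Y @^-1` A) w)%:E) (fun w => Q w A).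

End conditioning.

Section random_fields.
Context {R : realType} {d : nat} {dO : measure_display}
  {Omega : measurableType dO}.
Variable P : probability Omega R.
Local Notation V := 'rV[R]_d.

(* Product sigma-algebra on the space of fields [V -> V]. *)
Definition field_measurable : set (set (V -> V)) :=
  <<s \bigcup_(theta in [set: V])
        preimage_set_system setT (fun f : V -> V => (f theta : borel V))
          measurable >>.

Definition iid_fields (xi : nat -> Omega -> V -> V) : Prop :=
  (forall (J : seq nat) (B : nat -> set (V -> V)), uniq J ->
     (forall j, field_measurable (B j)) ->
     P (\bigcap_(j in [set` J]) (xi j @^-1` B j)) =
       (\prod_(j <- J) P (xi j @^-1` B j))%E) /\
  (forall (j : nat) (B : set (V -> V)), field_measurable B ->
     P (xi j @^-1` B) = P (xi 0%N @^-1` B)).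

End random_fields.

Section setting.
Context {R : realType} {d : nat} {X : pointedMetricType R}.
Local Notation V := 'rV[R]_d.

Definition invariant_law (K : R.-pker (borel X) ~> (borel X))
    (nu : probability (borel X) R) : Prop :=
  forall A : set (borel X), measurable A ->
    (\int[nu]_x K x A)%E = nu A.

Definition unique_invariant (K : R.-pker (borel X) ~> (borel X))
    (nu : probability (borel X) R) : Prop :=
  invariant_law K nu /\
  forall nu' : probability (borel X) R, invariant_law K nu' ->
    forall A : set (borel X), measurable A -> nu' A = nu A.

Definition mean_field (pi_ : V -> probability (borel X) R)
    (g : V -> X -> V) (theta : V) : V :=
  \row_i (\int[pi_ theta]_x (g theta x 0 i))%R.

Record regularity (g : V -> X -> V) (gbar : V -> V) (thetas : V) (L1 : R)
    : Prop := {
  reg_L1_gt0 : 0 < L1 ;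
  reg_C3 : forall x, Cn 3 (g ^~ x) ;
  reg_bound : forall (i : nat) x theta, (i <= 2)%N ->
    (opnorm (derivn (g ^~ x) i.+1 theta) <= L1%:E)%E ;
  reg_lip : forall (i : nat) x x' theta theta', (i <= 2)%N ->
    (opnorm (fun vs => derivn (g ^~ x) i theta vs -
                       derivn (g ^~ x') i theta' vs)%R
     <= (L1 * (enorm (theta - theta') + mdist x x'))%:E)%E ;
  reg_gbar_lip : forall theta theta',
    enorm (gbar theta - gbar theta') <= L1 * enorm (theta - theta') ;
  reg_growth : forall theta x,
    enorm (g theta x) <= L1 * (1 + enorm (theta - thetas))
}.

Definition monotonicity (gbar : V -> V) (mu : R) : Prop :=
  0 < mu /\ forall theta theta',
    edot (theta - theta') (gbar theta - gbar theta')
      <= - mu * enorm (theta - theta') ^+ 2.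

Record kernel_contraction (K : V -> R.-pker (borel X) ~> (borel X))
    (rho LP : R) : Prop := {
  ker_compact : compact [set: X] ;
  ker_rho : 0 < rho <= 1 ;
  ker_LP_gt0 : 0 < LP ;
  ker_contract : forall theta x x',
    (W2 (K theta x) (K theta x') <= ((1 - rho) * mdist x x')%:E)%E ;
  ker_lip : forall theta theta' x,
    (W2 (K theta x) (K theta' x) <= (LP * enorm (theta - theta'))%:E)%E
}.

Section process.
Context {dO : measure_display} {Omega : measurableType dO}.
Variable P : probability Omega R.
(* [xi k w theta] is the value at [theta] of the random field of index [k >= 1];
   [xi 0] is never used. *)
Variables (theta : nat -> Omega -> V) (x : nat -> Omega -> X)
  (xi : nat -> Omega -> V -> V).

Definition history (k : nat) : set (set Omega) :=
  <<s \bigcup_(t in [set t | (t <= k)%N])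
        (preimage_set_system setT (theta t : Omega -> borel V) measurable `|`
         preimage_set_system setT (x t : Omega -> borel X) measurable)
      `|`
      \bigcup_(t in [set t | (1 <= t <= k)%N])
         preimage_set_system setT (xi t) field_measurable >>.

Record sa_iterates (K : V -> R.-pker (borel X) ~> (borel X))
    (g : V -> X -> V) (alpha : R) : Prop := {
  sa_theta_meas : forall k,
    measurable_fun [set: Omega] (theta k : Omega -> borel V) ;
  sa_x_meas : forall k,
    measurable_fun [set: Omega] (x k : Omega -> borel X) ;
  sa_xi_meas : forall k t,
    measurable_fun [set: Omega] ((fun w => xi k.+1 w t) : Omega -> borel V) ;
  sa_rec : forall k w, theta k.+1 w =
    theta k w + alpha *: (g (theta k w) (x k.+1 w) + xi k.+1 w (theta k w)) ;
  sa_law : forall k,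
    is_cond_law P (history k) (x k.+1) (fun w => K (theta k w) (x k w))
}.

Record noise (p : nat) (thetas : V) (L2p Lxi : R) : Prop := {
  noise_adapted : forall k t,
    measurable_fun [set: g_sigma_algebraType (history k.+1)]
      ((fun w => xi k.+1 w t) : g_sigma_algebraType (history k.+1) -> borel V) ;
  noise_centered : forall k t i,
    is_cond_exp P (history k) (fun w => (xi k.+1 w t 0 i)%:E) (cst 0%E) ;
  noise_centered_iterate : forall k i,
    is_cond_exp P (history k) (fun w => (xi k.+1 w (theta k w) 0 i)%:E)
      (cst 0%E) ;
  noise_iid : iid_fields P (fun k => xi k.+1) ;
  noise_L2p_gt0 : 0 < L2p ;
  noise_moment : forall k, exists Z : Omega -> \bar R,
    is_cond_exp P (history k)
      (fun w => (enorm (xi k.+1 w (theta k w)) ^+ (2 * p))%:E) Z /\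
    {ae P, forall w,
      (Z w <= (L2p * (1 + enorm (theta k w - thetas) ^+ (2 * p)))%:E)%E} ;
  noise_Lxi_ge0 : 0 <= Lxi ;
  noise_lip : forall k t t',
    ('E_P[(fun w => enorm (xi k.+1 w t - xi k.+1 w t') ^+ 2)%R]
      <= (Lxi ^+ 2 * enorm (t - t') ^+ 2)%:E)%E
}.

End process.
End setting.

(* Main.v *)
Require Import Defs.
From mathcomp Require Import all_boot all_order all_algebra.
From mathcomp Require Import all_classical all_reals all_analysis measurable_realfun.
From mathcomp Require Import ring lra zify.
From mathcomp Require finmap.
Import Order.TTheory GRing.Theory Num.Theory.
Import numFieldNormedType.Exports.
Local Open Scope classical_set_scope.
Local Open Scope ring_scope.

(* Write D_k = theta_k - thetas and r_k = |D_k|.  Expanding r_{k+1}^{2n} leaves the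
   Markov-noise term <D_k, g(theta_k, X_{k+1}) - gbar(theta_k)> r_k^{2n-2}, which is
   removed by the corrector u_theta = sum_{j<N} P_theta^j (g_theta - gbar(theta)), a
   truncated solution of the Poisson equation: u - P_theta u = g - gbar up to an error
   O((1-rho)^N) <= alpha.  Thus, with v = P_theta u, the function
     V_k = r_k^{2n} + 2 n alpha r_k^{2n-2} <D_k, v_{theta_k}(X_k)>
   drifts like r_k^{2n} would if gbar replaced g.  Uniformly in N, v is bounded but
   only log-Lipschitz in theta; 1/2-Hoelder continuity is enough, because the resulting
   error alpha r^{2n-1} sqrt(alpha (1 + r + |xi|)) carries a factor r and is absorbed by
   the contraction -2 n alpha mu r^{2n}, at the cost of O(alpha^{n+1}).  Hence
   E V_{k+1} <= (1 - n alpha mu) E V_k + O(alpha^{n+1}), and V_k is comparable to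
   r_k^{2n} up to O(alpha^{n+1}). *)

(** * Euclidean norm *)

Section euclid.
Context {R : realType} {d : nat}.
Implicit Types u v w : 'rV[R]_d.

(** The corrector uses v = P_theta u rather than u because u_{theta_k}(X_{k+1}) - v_{theta_k}(X_k)
    is a martingale difference for the history. Read at X_{k+1}, the Poisson equation splits the
    Markov noise into this difference plus v_{theta_k}(X_k) - v_{theta_k}(X_{k+1}), and the
    corrector telescopes the latter up to the change of theta. The Lipschitz constant of P_theta^j
    f_theta in theta is bounded in j but is not shown to decay, so the sum over j < N loses a factor
    N, and N grows as alpha decreases. Every bound on u must be uniform in N, which is why the
    Hoelder estimate replaces the Lipschitz one. The noise has only 2p conditional moments. The
    pathwise estimates keep it as the ratio |xi| / (1 + r) raised to the power 2p, whose conditional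
    mean is at most 2 [L2p]; this is where n <= p enters. The conditional law of X_{k+1} is given
    set by set, while the test functions also depend on theta_k; compactness of the state space
    reduces them to finitely many sets. *)

Lemma edotC u v : edot u v = edot v u.
Proof. by apply: eq_bigr => i _; rewrite mulrC. Qed.

Lemma edotDl u v w : edot (u + v) w = edot u w + edot v w.
Proof. by rewrite -big_split; apply: eq_bigr => i _; rewrite !mxE mulrDl. Qed.

Lemma edotDr u v w : edot u (v + w) = edot u v + edot u w.
Proof. by rewrite edotC edotDl !(edotC _ u). Qed.

Lemma edotZl (c : R) u v : edot (c *: u) v = c * edot u v.
Proof. by rewrite mulr_sumr; apply: eq_bigr => i _; rewrite mxE mulrA. Qed.

Lemma edotZr (c : R) u v : edot u (c *: v) = c * edot u v.
Proof. by rewrite edotC edotZl edotC. Qed.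

Lemma edotBr u v w : edot u (v - w) = edot u v - edot u w.
Proof. by rewrite -scaleN1r edotDr edotZr mulN1r. Qed.

Lemma edot0 u : edot u 0 = 0.
Proof. by rewrite -(scale0r u) edotZr mul0r. Qed.

Lemma edot_ge0 u : 0 <= edot u u.
Proof. by apply: sumr_ge0 => i _; rewrite -expr2 sqr_ge0. Qed.

Lemma enorm_ge0 u : 0 <= enorm u.
Proof. exact: sqrtr_ge0. Qed.

Lemma sqr_enorm u : enorm u ^+ 2 = edot u u.
Proof. by rewrite sqr_sqrtr // edot_ge0. Qed.

Lemma enorm0 : enorm (0 : 'rV[R]_d) = 0.
Proof. by rewrite /enorm edot0 sqrtr0. Qed.

(** The squared norm of <v,v> u - <u,v> v is nonnegative and contains a factor <v,v>, which can be
    divided out unless all coordinates of v vanish. *)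
Lemma edot_sqr_le u v : edot u v ^+ 2 <= edot u u * edot v v.
Proof.
have key : 0 <= edot v v * (edot u u * edot v v - edot u v ^+ 2).
  have := edot_ge0 (edot v v *: u - edot u v *: v).
  rewrite edotBr !(edotC (_ - _)) !edotBr !edotZr !(edotC (_ *: _)) !edotZr.
  by rewrite (edotC v u) => h; apply: le_trans h _; lra.
have [v0|v0] := ltrP 0 (edot v v); first by rewrite -subr_ge0 -(pmulr_rge0 _ v0).
have /eqP : edot v v = 0 by apply/eqP; rewrite eq_le v0 edot_ge0.
rewrite psumr_eq0 => [/allP h|i _]; last by rewrite -expr2 sqr_ge0.
rewrite (_ : edot u v = 0) ?expr0n ?mulr_ge0 ?edot_ge0//.
apply: big1 => i _; have := h i; rewrite mem_index_enum => /(_ isT).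
by rewrite mulf_eq0 orbb => /eqP ->; rewrite mulr0.
Qed.

Lemma cauchy_schwarz u v : `|edot u v| <= enorm u * enorm v.
Proof.
rewrite -ler_sqr ?nnegrE ?mulr_ge0 ?enorm_ge0//.
by rewrite real_normK ?num_real// exprMn !sqr_enorm edot_sqr_le.
Qed.

Lemma edot_le u v : edot u v <= enorm u * enorm v.
Proof. exact: le_trans (ler_norm _) (cauchy_schwarz u v). Qed.

Lemma sqr_enormD u v :
  enorm (u + v) ^+ 2 = enorm u ^+ 2 + 2 * edot u v + enorm v ^+ 2.
Proof. by rewrite !sqr_enorm !(edotDl, edotDr) (edotC v u); ring. Qed.

Lemma enormD u v : enorm (u + v) <= enorm u + enorm v.
Proof.
rewrite -ler_sqr ?nnegrE ?addr_ge0 ?enorm_ge0// sqr_enormD.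
by have := edot_le u v; nra.
Qed.

Lemma enormZ (c : R) u : enorm (c *: u) = `|c| * enorm u.
Proof.
by rewrite /enorm edotZl edotZr mulrA -expr2 sqrtrM ?sqr_ge0// sqrtr_sqr.
Qed.

Lemma enormB u v : enorm (u - v) = enorm (v - u).
Proof. by rewrite -opprB -scaleN1r enormZ normrN1 mul1r. Qed.

Lemma ler_coord_enorm u i : `|u 0 i| <= enorm u.
Proof.
rewrite -ler_sqr ?nnegrE ?enorm_ge0// real_normK ?num_real// sqr_enorm.
rewrite /edot (bigD1 i)//= -expr2 lerDl sumr_ge0// => j _.
by rewrite -expr2 sqr_ge0.
Qed.

Lemma enorm_le_sum u : enorm u <= \sum_i `|u 0 i|.
Proof.
have s0 (I : seq 'I_d) : 0 <= \sum_(i <- I) `|u 0 i| by exact: sumr_ge0.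
rewrite -ler_sqr ?nnegrE ?enorm_ge0 ?s0// sqr_enorm /edot.
elim: (index_enum _) => [|i I IH]; first by rewrite !big_nil.
rewrite !big_cons; set S := \sum_(j <- I) `|u 0 j| in IH *.
have := s0 I; rewrite -/S => S0; have := normr_ge0 (u 0 i).
have : u 0 i * u 0 i = `|u 0 i| ^+ 2 by rewrite real_normK ?num_real// expr2.
by move=> -> ?; nra.
Qed.

(** Mean value bound for t^m between |u| and |u + v|, multiplied by |u| + |v| so that the exponent m
    - 1, truncated at m = 0, does not appear. Induction through p^(m+1) - q^(m+1) = p (p^m - q^m) +
    (p - q) q^m. *)
Lemma enorm_expr_diff (m : nat) u v :
  `|enorm (u + v) ^+ m - enorm u ^+ m| * (enorm u + enorm v) <=
    m%:R * enorm v * (enorm u + enorm v) ^+ m.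
Proof.
have p0 := enorm_ge0 (u + v); have q0 := enorm_ge0 u; have a0 := enorm_ge0 v.
have pM := enormD u v.
have pq : `|enorm (u + v) - enorm u| <= enorm v.
  rewrite ler_norml lerBlDl pM andbT.
  have := enormD (u + v) (- v); rewrite addrK -scaleN1r enormZ normrN1 mul1r.
  by lra.
move: (enorm (u + v)) (enorm u) (enorm v) p0 q0 a0 pM pq => p q a.
move=> p0 q0 a0 pM pq; elim: m => [|m IH].
  by rewrite !expr0 subrr normr0 !mul0r.
have -> : p ^+ m.+1 - q ^+ m.+1 = p * (p ^+ m - q ^+ m) + (p - q) * q ^+ m.
  by rewrite !exprS; ring.
have h1 : q ^+ m <= (q + a) ^+ m by rewrite lerXn2r ?nnegrE//; lra.
have q0m : 0 <= q ^+ m by exact: exprn_ge0.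
apply: (@le_trans _ _ ((p * `|p ^+ m - q ^+ m| + `|p - q| * q ^+ m) * (q + a))).
  rewrite ler_wpM2r// ?addr_ge0//; apply: le_trans (ler_normD _ _) _.
  by rewrite !normrM (ger0_norm p0) (ger0_norm q0m).
rewrite mulrDl -mulrA mulrS !mulrDl mul1r addrC lerD//.
  by rewrite exprSr mulrA ler_wpM2r ?addr_ge0// ler_pM// normr_ge0.
apply: (@le_trans _ _ ((q + a) * (m%:R * a * (q + a) ^+ m))).
  by apply: ler_pM => //; rewrite mulr_ge0 ?normr_ge0 ?addr_ge0.
by rewrite exprS [leLHS]mulrCA.
Qed.

(** One-sided second-order Taylor bound, obtained without calculus: the induction multiplies the
    previous bound by |u + v|^2 = |u|^2 + 2 <u,v> + |v|^2. *)
Lemma enorm_expr_taylor (m : nat) : exists2 C : R, 0 <= C & forall u v,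
  enorm (u + v) ^+ (2 * m.+1) <=
    enorm u ^+ (2 * m.+1) +
    (2 * m.+1)%:R * enorm u ^+ (2 * m) * edot u v +
    C * enorm v ^+ 2 * (enorm u + enorm v) ^+ (2 * m).
Proof.
elim: m => [|m [C C0 IH]].
  exists 1 => // u v.
  by rewrite muln0 muln1 !expr0 sqr_enormD mul1r !mulr1.
(* [C] carries the previous remainder, 1 pays for |u|^(2m) |u|^2 |v|^2, and the last summand for the
   product of the old linear term with 2 <u,v> + |v|^2. *)
exists (C + 1 + 2 * (2 * m.+1)%:R)%R; first by rewrite !addr_ge0 ?mulr_ge0.
move=> u v.
have r0 := enorm_ge0 u; have a0 := enorm_ge0 v.
have := IH u v; set X := enorm (u + v) ^+ (2 * m.+1) => hX.
have -> : enorm (u + v) ^+ (2 * m.+2) = X * enorm (u + v) ^+ 2.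
  by rewrite -exprD; congr (_ ^+ _); rewrite mulnS addnC.
have P2 : enorm (u + v) ^+ 2 <= (enorm u + enorm v) ^+ 2.
  by rewrite lerXn2r ?nnegrE ?addr_ge0 ?enorm_ge0// enormD.
have e1 : `|edot u v| <= enorm u * enorm v := cauchy_schwarz u v.
have P0 : 0 <= enorm (u + v) ^+ 2 by exact: sqr_ge0.
have -> : enorm u ^+ (2 * m.+2) = enorm u ^+ (2 * m) * enorm u ^+ 2 * enorm u ^+ 2.
  by rewrite -!exprD; congr (_ ^+ _); rewrite !mulnS; lia.
have E1 : enorm u ^+ (2 * m.+1) = enorm u ^+ (2 * m) * enorm u ^+ 2.
  by rewrite -exprD; congr (_ ^+ _); rewrite mulnS addnC.
have E2 : (enorm u + enorm v) ^+ (2 * m.+1) =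
    (enorm u + enorm v) ^+ (2 * m) * (enorm u + enorm v) ^+ 2.
  by rewrite -exprD; congr (_ ^+ _); rewrite mulnS addnC.
rewrite E1 in hX *; rewrite E2.
have rm : 0 <= enorm u ^+ (2 * m) <= (enorm u + enorm v) ^+ (2 * m).
  by rewrite exprn_ge0//= lerXn2r ?nnegrE ?addr_ge0// lerDl.
have -> : (2 * m.+2)%:R = (2 * m.+1)%:R + 2 :> R.
  by rewrite -natrD addn2 mulnS.
have : 0 <= (2 * m.+1)%:R :> R by [].
move: rm e1 P2 P0 hX r0 a0; rewrite (sqr_enormD u v).
move: (enorm u ^+ (2 * m)) ((enorm u + enorm v) ^+ (2 * m)) (2 * m.+1)%:R.
move: (enorm u) (enorm v) (edot u v) X => r a e X rho M k.
move=> /andP[rho0 rhoM] e1 P2 P0 hX r0 a0 k0.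
apply: (le_trans (ler_wpM2r P0 hX)).
have hC : C * a ^+ 2 * M * (r ^+ 2 + 2 * e + a ^+ 2) <= C * a ^+ 2 * M * (r + a) ^+ 2.
  by rewrite ler_wpM2l// !mulr_ge0 ?sqr_ge0// (le_trans rho0).
have h1 : rho * r ^+ 2 * a ^+ 2 <= a ^+ 2 * (M * (r + a) ^+ 2).
  rewrite mulrC ler_wpM2l ?sqr_ge0// ler_pM ?sqr_ge0//.
  by rewrite ler_sqr ?nnegrE ?addr_ge0// lerDl.
have h2 : k * (rho * (e * (2 * e + a ^+ 2))) <= 2 * k * a ^+ 2 * (M * (r + a) ^+ 2).
  have -> : 2 * k * a ^+ 2 * (M * (r + a) ^+ 2) = k * (M * (2 * a ^+ 2 * (r + a) ^+ 2)).
    by ring.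
  rewrite ler_wpM2l//.
  apply: (@le_trans _ _ (rho * (2 * a ^+ 2 * (r + a) ^+ 2))); last first.
    by rewrite ler_wpM2r// mulr_ge0 ?sqr_ge0// mulr_ge0 ?sqr_ge0.
  rewrite ler_wpM2l//.
  have ra : 0 <= r * a by exact: mulr_ge0.
  have : e * e <= (r * a) * (r * a).
    have := @ler_pM _ _ _ _ _ (normr_ge0 e) (normr_ge0 e) e1 e1.
    by rewrite -normrM -expr2 ger0_norm ?sqr_ge0.
  have : e * a ^+ 2 <= r * a * a ^+ 2.
    by rewrite ler_wpM2r ?sqr_ge0// (le_trans (ler_norm _)).
  have h3 : 0 <= a * a * (r * a) by rewrite !mulr_ge0.
  have h4 : 0 <= a * a * (a * a) by rewrite !mulr_ge0.
  by rewrite !expr2; lra.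
rewrite -subr_ge0.
set D := (X in 0 <= X).
have -> : D = (C * a ^+ 2 * M * (r + a) ^+ 2 - C * a ^+ 2 * M * (r ^+ 2 + 2 * e + a ^+ 2))
  + (a ^+ 2 * (M * (r + a) ^+ 2) - rho * r ^+ 2 * a ^+ 2)
  + (2 * k * a ^+ 2 * (M * (r + a) ^+ 2) - k * (rho * (e * (2 * e + a ^+ 2)))).
  by rewrite /D; ring.
by apply: addr_ge0; [apply: addr_ge0|]; rewrite subr_ge0.
Qed.

End euclid.

(** * Scalar estimates *)

Ltac nonneg := repeat (first [done | exact: ltW | rewrite exprn_ge0// |
  apply: addr_ge0 | apply: mulr_ge0 | rewrite invr_ge0 | apply: enorm_ge0 |
  apply: sqrtr_ge0]).

Section scalar.
Context {R : realType}.
Implicit Types (x y s r z a alpha eta : R) (j k m p : nat).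

Lemma exprD_le x y j : 0 <= x -> 0 <= y ->
  (x + y) ^+ j <= 2 ^+ j * (x ^+ j + y ^+ j).
Proof.
wlog xy : x y / x <= y => [wh x0 y0|x0 y0].
  have [|/ltW yx] := leP x y; first by move=> ?; exact: wh.
  by rewrite addrC [X in _ * X]addrC; exact: wh.
apply: (@le_trans _ _ ((2 * y) ^+ j)).
  by rewrite lerXn2r ?nnegrE ?addr_ge0 ?mulr_ge0//; lra.
by rewrite exprMn ler_wpM2l ?exprn_ge0// lerDr exprn_ge0.
Qed.

Lemma expr_le1D s j k : 0 <= s -> (j <= k)%N -> s ^+ j <= 1 + s ^+ k.
Proof.
move=> s0 jk; have [s1|/ltW s1] := leP s 1.
  by apply: (@le_trans _ _ 1); [exact: exprn_ile1|rewrite lerDl exprn_ge0].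
by rewrite (le_trans (ler_weXn2l s1 jk))// lerDr.
Qed.

Lemma expr1D_le s j k : 0 <= s -> (j <= k)%N ->
  (1 + s) ^+ j <= 2 ^+ j.+1 * (1 + s ^+ k).
Proof.
move=> s0 jk; apply: le_trans (exprD_le 1 s j _ s0) _ => //.
rewrite exprSr -mulrA ler_wpM2l ?exprn_ge0// expr1n.
have := expr_le1D s j k s0 jk; have := exprn_ge0 k s0; lra.
Qed.

(** Either [alpha <= eta * r ^+ 2], and the first term suffices, or r^2 is at most alpha / eta, and
    the second does. It trades a lower power of r for a small share of the contraction and a power
    of alpha. *)
Lemma young_expr alpha r eta m : 0 <= alpha -> 0 <= r -> 0 < eta ->
  alpha * r ^+ (2 * m) <=
    eta * r ^+ (2 * m.+1) + (eta^-1) ^+ m * alpha ^+ m.+1.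
Proof.
move=> a0 r0 e0; have e0' : 0 <= eta^-1 by rewrite invr_ge0 ltW.
have [h|/ltW h] := leP alpha (eta * r ^+ 2).
  have -> : r ^+ (2 * m.+1) = r ^+ 2 * r ^+ (2 * m).
    by rewrite -exprD mulnS.
  rewrite -[leLHS]addr0 mulrA lerD//; first by rewrite ler_wpM2r// exprn_ge0.
  by rewrite mulr_ge0// exprn_ge0.
rewrite -[leLHS]add0r lerD//; first by rewrite mulr_ge0 ?exprn_ge0// ltW.
rewrite exprS mulrCA ler_wpM2l// -exprMn exprM lerXn2r ?nnegrE ?mulr_ge0 ?sqr_ge0//.
by rewrite ler_pdivlMl.
Qed.

(** All drift errors in scalar form, with r the error norm, z the noise norm and a the length of the
    increment. [c1] weighs the Poisson truncation, [c2] the Hoelder change of the corrector, [c3]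
    the Taylor remainder, [c4] the change of the factors multiplying the corrector. Each fits into
    the share [eta] of the contraction plus O(alpha^(m+2)), up to a factor that carries all the
    noise. *)
Lemma lyapunov_scalar_error p m (c1 c2 c3 c4 L eta : R) : (m < p)%N ->
  0 <= c1 -> 0 <= c2 -> 0 <= c3 -> 0 <= c4 -> 0 <= L -> 0 < eta ->
  exists C alpha0, [/\ 0 <= C, 0 < alpha0 <= 1 & forall alpha r z a,
    0 < alpha < alpha0 -> 0 <= r -> 0 <= z ->
    0 <= a <= alpha * (L * (1 + r) + z) ->
    alpha * (c1 * alpha * r ^+ (2 * m).+1 + c2 * r ^+ (2 * m).+1 * Num.sqrt a) +
      c3 * a ^+ 2 * (r + a) ^+ (2 * m) + c4 * alpha * a * (r + a) ^+ (2 * m)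
    <= (eta * alpha * r ^+ (2 * m.+1) + C * alpha ^+ m.+2) *
       (1 + (z / (1 + r)) ^+ (2 * p))].
Proof.
move=> mp c10 c20 c30 c40 L0 eta0.
pose Q := (2 ^+ 2 * (L + 1)) ^+ (2 * m.+1).
pose B := 2 ^+ (2 * m.+1).+1 : R.
pose D := c1 + c2 ^+ 2 / (2 * eta) * Q * 2 + c3 * 2 ^+ (2 * m) * (Q * 2 + Q * B)
  + c4 * 2 ^+ (2 * m) * (Q * 2 + Q * B).
have Q0 : 0 <= Q by rewrite exprn_ge0// mulr_ge0// addr_ge0.
have B0 : 0 <= B by rewrite exprn_ge0.
have c2e : 0 <= c2 ^+ 2 / (2 * eta).
  by rewrite mulr_ge0 ?sqr_ge0// invr_ge0 mulr_ge0// ltW.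
have q2m : 0 <= 2 ^+ (2 * m) :> R by exact: exprn_ge0.
have D0 : 0 <= D by rewrite /D; nonneg.
(* A quarter of the budget [eta] for each of two uses: the Young inequality, and alpha <= [e1]. *)
pose e1 := eta / (4 * (D + 1)).
have e10 : 0 < e1 by rewrite divr_gt0// mulr_gt0// ltr_wpDl.
have De1 : D * e1 <= eta / 4.
  rewrite /e1 mulrA ler_pdivrMr ?mulr_gt0 ?ltr_wpDl//.
  have -> : eta / 4 * (4 * (D + 1)) = D * eta + eta by field.
  by rewrite lerDl ltW.
exists (D * ((e1^-1) ^+ m + 1)), (Num.min 1 e1); split.
- by rewrite mulr_ge0// addr_ge0// exprn_ge0// invr_ge0 ltW.
- by rewrite lt_min ltr01 e10 ge_min lexx.
move=> alpha r z a /andP[al0]; rewrite lt_min => /andP[al1 ale] r0 z0 /andP[a0 ha].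
set s := z / (1 + r); set T := 1 + _.
have b0 : 0 < 1 + r by rewrite ltr_wpDr.
have s0 : 0 <= s by rewrite divr_ge0// ltW.
have T1 : 1 <= T by rewrite lerDl exprn_ge0.
have T0 : 0 <= T := le_trans ler01 T1.
(* Writing z = s (1 + r) makes a at most (L + 1) alpha (1 + r) (1 + s); then (1 + s)^j is absorbed
   in [T] since j <= 2p. Positivity of j gives 2^(j+1) <= 4^j. *)
have aj j : (0 < j <= 2 * m.+1)%N -> a ^+ j <= Q * alpha ^+ j * (1 + r) ^+ j * T.
  move=> /andP[j0 jm].
  have jp : (j <= 2 * p)%N by rewrite (leq_trans jm)// leq_mul2l.
  have h : a <= (L + 1) * (alpha * (1 + r)) * (1 + s).
    apply: le_trans ha _.
    have -> : z = s * (1 + r) by rewrite /s mulfVK// gt_eqF.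
    rewrite (_ : (L + 1) * _ * _ = alpha * ((L + 1) * (1 + s) * (1 + r))); last by ring.
    rewrite ler_pM2l// -mulrDl ler_pM2r//.
    by have := mulr_ge0 L0 s0; lra.
  have := @lerXn2r _ j a _ a0 _ h.
  rewrite nnegrE => /(_ (le_trans a0 h)) /le_trans; apply.
  rewrite !exprMn.
  have -> : Q * alpha ^+ j * (1 + r) ^+ j * T = Q * T * (alpha ^+ j * (1 + r) ^+ j).
    by ring.
  rewrite mulrAC ler_wpM2r ?mulr_ge0 ?exprn_ge0 ?(ltW al0) ?(ltW b0)//.
  apply: (@le_trans _ _ ((L + 1) ^+ j * (2 ^+ j.+1 * T))).
    by apply: ler_wpM2l; [nonneg|exact: expr1D_le].
  rewrite mulrA ler_wpM2r// /Q.
  apply: (@le_trans _ _ ((2 ^+ 2 * (L + 1)) ^+ j)); last first.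
    by apply: ler_weXn2l => //; lra.
  rewrite exprMn mulrC; apply: ler_wpM2r; first by nonneg.
  by rewrite -exprM ler_weXn2l ?ler1n// mul2n -addnn -addn1 leq_add2l.
have r2m : r ^+ (2 * m.+1) = r ^+ 2 * r ^+ (2 * m).
  by rewrite -exprD mulnS.
have r1m : r ^+ (2 * m).+1 = r * r ^+ (2 * m) by rewrite exprS.
set x := r ^+ (2 * m) in r2m r1m *; set y := r ^+ (2 * m.+1) in r2m *.
have x0 : 0 <= x by exact: exprn_ge0.
have y0 : 0 <= y by exact: exprn_ge0.
have rx : r * x <= x + y.
  by rewrite r2m; have := sqr_ge0 (r - 1); rewrite !expr2; nra.
have bx : (1 + r) * x <= 2 * (x + y) by rewrite mulrDl mul1r; lra.
have b2x : (1 + r) ^+ 2 * x <= 2 * (x + y).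
  by rewrite r2m; have := sqr_ge0 (r - 1); rewrite !expr2; nra.
have by2 : (1 + r) ^+ (2 * m.+1) <= B * (1 + y) by exact: expr1D_le.
have by1 : (1 + r) ^+ (2 * m).+1 <= B * (1 + y).
  by apply: le_trans by2; apply: ler_weXn2l; [rewrite lerDl|rewrite mulnS].
pose A := alpha ^+ m.+2.
have A0 : 0 <= A by rewrite exprn_ge0// ltW.
have al2m : alpha ^+ (2 * m.+1) <= A.
  by apply: ler_wiXn2l; [exact: ltW|exact: ltW|rewrite mulnS mul2n -addnn !addSn !ltnS ?addnS ?leq_addr].
have al2 : alpha ^+ (2 * m.+1) <= alpha ^+ 2.
  by apply: ler_wiXn2l; [exact: ltW|exact: ltW|rewrite mulnS].
(* Common scale of the errors: each is at most a constant times [T * E], except for the part of the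
   Hoelder term charged directly to the contraction. *)
pose E := alpha ^+ 2 * (x + y) + A.
have E0 : 0 <= E by rewrite addr_ge0// mulr_ge0 ?sqr_ge0 ?addr_ge0.
have alE : alpha ^+ (2 * m.+1) * (1 + y) <= E.
  rewrite mulrDr mulr1 addrC lerD//; apply: ler_pM => //.
  by rewrite exprn_ge0// ltW.
  by rewrite lerDr.
have ax : alpha * a * x <= Q * 2 * T * E.
  have := aj 1%N isT; rewrite !expr1 => h.
  apply: (@le_trans _ _ (alpha * (Q * alpha * (1 + r) * T) * x)).
    by rewrite ler_wpM2r// ler_wpM2l// ltW.
  have -> : alpha * (Q * alpha * (1 + r) * T) * x = Q * T * (alpha ^+ 2 * ((1 + r) * x)).
    by ring.
  have -> : Q * 2 * T * E = Q * T * (2 * E) by ring.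
  rewrite ler_wpM2l ?mulr_ge0//.
  apply: (@le_trans _ _ (alpha ^+ 2 * (2 * (x + y)))).
    by rewrite ler_wpM2l ?sqr_ge0.
  by rewrite mulrCA ler_wpM2l// lerDl.
have a2x : a ^+ 2 * x <= Q * 2 * T * E.
  have h : a ^+ 2 <= Q * alpha ^+ 2 * (1 + r) ^+ 2 * T by apply: aj; rewrite mulnS.
  apply: (@le_trans _ _ ((Q * alpha ^+ 2 * (1 + r) ^+ 2 * T) * x)).
    by rewrite ler_wpM2r.
  have -> : Q * alpha ^+ 2 * (1 + r) ^+ 2 * T * x =
    Q * T * (alpha ^+ 2 * ((1 + r) ^+ 2 * x)) by ring.
  have -> : Q * 2 * T * E = Q * T * (2 * E) by ring.
  rewrite ler_wpM2l ?mulr_ge0//.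
  apply: (@le_trans _ _ (alpha ^+ 2 * (2 * (x + y)))).
    by rewrite ler_wpM2l ?sqr_ge0.
  by rewrite mulrCA ler_wpM2l// lerDl.
have aQB : a ^+ (2 * m.+1) <= Q * B * T * E.
  apply: le_trans (aj _ _) _; first by rewrite leqnn muln_gt0.
  have -> : Q * alpha ^+ (2 * m.+1) * (1 + r) ^+ (2 * m.+1) * T =
    Q * T * (alpha ^+ (2 * m.+1) * (1 + r) ^+ (2 * m.+1)) by ring.
  have -> : Q * B * T * E = Q * T * (B * E) by ring.
  rewrite ler_wpM2l ?mulr_ge0//.
  apply: (@le_trans _ _ (alpha ^+ (2 * m.+1) * (B * (1 + y)))).
    by rewrite ler_wpM2l// exprn_ge0// ltW.
  by rewrite mulrCA ler_wpM2l.
have aQB1 : alpha * a ^+ (2 * m).+1 <= Q * B * T * E.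
  apply: (@le_trans _ _ (alpha * (Q * alpha ^+ (2 * m).+1 * (1 + r) ^+ (2 * m).+1 * T))).
    by apply: ler_wpM2l; [exact: ltW|apply: aj; rewrite mulnS leqnSn].
  have -> : alpha * (Q * alpha ^+ (2 * m).+1 * (1 + r) ^+ (2 * m).+1 * T) =
    Q * T * (alpha ^+ (2 * m.+1) * (1 + r) ^+ (2 * m).+1).
    rewrite (_ : alpha ^+ (2 * m.+1) = alpha * alpha ^+ (2 * m).+1); last first.
      by rewrite -exprS mulnS.
    by move: (alpha ^+ (2 * m).+1) ((1 + r) ^+ (2 * m).+1) => ? ?; ring.
  have -> : Q * B * T * E = Q * T * (B * E) by ring.
  rewrite ler_wpM2l ?mulr_ge0//.
  apply: (@le_trans _ _ (alpha ^+ (2 * m.+1) * (B * (1 + y)))).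
    by rewrite ler_wpM2l// exprn_ge0// ltW.
  by rewrite mulrCA ler_wpM2l.
have ram : (r + a) ^+ (2 * m) <= 2 ^+ (2 * m) * (x + a ^+ (2 * m)) by exact: exprD_le.
have t3 : c3 * a ^+ 2 * (r + a) ^+ (2 * m) <= c3 * 2 ^+ (2 * m) * (Q * 2 + Q * B) * (T * E).
  apply: (@le_trans _ _ (c3 * a ^+ 2 * (2 ^+ (2 * m) * (x + a ^+ (2 * m))))).
    by rewrite ler_wpM2l// mulr_ge0// sqr_ge0.
  have -> : c3 * a ^+ 2 * (2 ^+ (2 * m) * (x + a ^+ (2 * m))) =
    c3 * 2 ^+ (2 * m) * (a ^+ 2 * x + a ^+ (2 * m.+1)).
    by rewrite mulnS [a ^+ (2 + _)]exprD; ring.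
  rewrite -[leRHS]mulrA; apply: ler_wpM2l; [exact: mulr_ge0|lra].
have t4 : c4 * alpha * a * (r + a) ^+ (2 * m) <= c4 * 2 ^+ (2 * m) * (Q * 2 + Q * B) * (T * E).
  apply: (@le_trans _ _ (c4 * alpha * a * (2 ^+ (2 * m) * (x + a ^+ (2 * m))))).
    by rewrite ler_wpM2l// !mulr_ge0// ltW.
  have -> : c4 * alpha * a * (2 ^+ (2 * m) * (x + a ^+ (2 * m))) =
    c4 * 2 ^+ (2 * m) * (alpha * a * x + alpha * a ^+ (2 * m).+1).
    by rewrite [a ^+ (2 * m).+1]exprS; ring.
  rewrite -[leRHS]mulrA; apply: ler_wpM2l; [exact: mulr_ge0|lra].
have t1 : alpha * (c1 * alpha * r ^+ (2 * m).+1) <= c1 * (T * E).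
  rewrite r1m.
  have -> : alpha * (c1 * alpha * (r * x)) = c1 * (alpha ^+ 2 * (r * x)) by ring.
  rewrite ler_wpM2l//; apply: (@le_trans _ _ E); last by rewrite ler_peMl.
  by rewrite -[leLHS]addr0 lerD// ler_wpM2l ?sqr_ge0.
have t2 : alpha * (c2 * r ^+ (2 * m).+1 * Num.sqrt a) <=
    eta / 2 * alpha * y + c2 ^+ 2 / (2 * eta) * Q * 2 * (T * E).
  (* Weighted arithmetic-geometric mean; the weight spends exactly half of [eta] on r^2 and leaves a
     term linear in a. *)
  have sq : c2 * r * Num.sqrt a <= eta / 2 * r ^+ 2 + c2 ^+ 2 / (2 * eta) * a.
    have := sqr_ge0 (eta * r - c2 * Num.sqrt a).
    rewrite sqrrB !exprMn sqr_sqrtr// => h.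
    rewrite -subr_ge0 (_ : _ - _ = (eta ^+ 2 * r ^+ 2 -
      (eta * r * (c2 * Num.sqrt a)) *+ 2 + c2 ^+ 2 * a) / (2 * eta)).
      by rewrite divr_ge0// mulr_ge0// ltW.
    by field; rewrite gt_eqF.
  apply: (@le_trans _ _ (alpha * x * (eta / 2 * r ^+ 2 + c2 ^+ 2 / (2 * eta) * a))).
    rewrite r1m (_ : alpha * _ = alpha * x * (c2 * r * Num.sqrt a)); last by ring.
    by rewrite ler_wpM2l// mulr_ge0// ltW.
  rewrite (_ : alpha * x * _ =
    eta / 2 * alpha * y + c2 ^+ 2 / (2 * eta) * (alpha * a * x)); last first.
    by rewrite r2m; ring.
  rewrite lerD2l.
  move: (c2 ^+ 2 / (2 * eta)) c2e => c c0'; rewrite -!mulrA.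
  by apply: ler_wpM2l => //; rewrite !mulrA.
(* The other half of the budget: alpha^2 r^(2m) is treated by [young_expr], alpha^2 r^(2m+2) by
   alpha <= [e1]. *)
have DE : D * E <= eta / 2 * alpha * y + D * ((e1^-1) ^+ m + 1) * A.
  have h := young_expr alpha r e1 m (ltW al0) r0 e10.
  have h1 : D * (alpha * (alpha * x)) <=
      D * (alpha * (e1 * y + (e1^-1) ^+ m * alpha ^+ m.+1)).
    by rewrite !ler_wpM2l// ltW.
  have h2 : D * e1 * (alpha * y) <= eta / 4 * (alpha * y).
    by rewrite ler_wpM2r// mulr_ge0// ltW.
  have h3 : D * (alpha * (alpha * y)) <= D * e1 * (alpha * y).
    rewrite -[leRHS]mulrA ler_wpM2l// ler_wpM2r ?mulr_ge0 ?(ltW al0)// ltW//.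
  have -> : D * E = D * (alpha * (alpha * x)) + D * (alpha * (alpha * y)) + D * A.
    by rewrite /E; ring.
  have h4 : D * (alpha * (e1 * y + (e1^-1) ^+ m * alpha ^+ m.+1)) =
    D * e1 * (alpha * y) + D * (e1^-1) ^+ m * A by rewrite /A [in RHS]exprS; ring.
  by rewrite h4 in h1; lra.
have h5 : eta / 2 * alpha * y <= eta / 2 * alpha * y * T.
  by apply: ler_peMr => //; nonneg.
have h6 : T * (D * E) <= T * (eta / 2 * alpha * y + D * ((e1^-1) ^+ m + 1) * A).
  by rewrite ler_wpM2l.
have -> : (eta * alpha * y + D * (e1^-1 ^+ m + 1) * A) * T =
  eta / 2 * alpha * y * T + T * (eta / 2 * alpha * y + D * ((e1^-1) ^+ m + 1) * A).
  by field.
apply: le_trans (lerD h5 h6).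
have -> : T * (D * E) = c1 * (T * E) + c2 ^+ 2 / (2 * eta) * Q * 2 * (T * E) +
  c3 * 2 ^+ (2 * m) * (Q * 2 + Q * B) * (T * E) +
  c4 * 2 ^+ (2 * m) * (Q * 2 + Q * B) * (T * E) by rewrite /D; ring.
rewrite mulrDr; lra.
Qed.

End scalar.

(** * The perturbed Lyapunov function *)

Section lyapunov.
Context {R : realType} {d : nat}.
Implicit Types x u v : 'rV[R]_d.

(** Here m = n - 1, which avoids the truncated exponent 2n - 2. The vector [v] is left free, so that
    the estimates below are deterministic; it becomes the value of the corrector. *)
Definition lyapunov (m : nat) (alpha : R) x v : R :=
  enorm x ^+ (2 * m.+1) +
  (2 * m.+1)%:R * alpha * enorm x ^+ (2 * m) * edot x v.

(** The corrector term is at most B alpha |x|^(2m+1) / 2. If B alpha <= |x| it is below |x|^(2m+2) /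
    2; otherwise |x| <= B alpha and it is of order alpha^(2m+2), hence O(alpha^(m+2)) since alpha <=
    1. *)
Lemma lyapunov_dist (m : nat) (Cv : R) : 0 <= Cv ->
  exists2 C, 0 <= C & forall alpha x v, 0 < alpha <= 1 -> enorm v <= Cv ->
    `|lyapunov m alpha x v - enorm x ^+ (2 * m.+1)| <=
      enorm x ^+ (2 * m.+1) / 2 + C * alpha ^+ m.+2.
Proof.
move=> Cv0; pose B := 2 * ((2 * m.+1)%:R * Cv).
have B0 : 0 <= B by rewrite /B; nonneg.
exists (B ^+ (2 * m.+1)); first exact: exprn_ge0.
move=> alpha x v /andP[al0 al1] vC; rewrite /lyapunov addrC addKr.
have r0 := enorm_ge0 x.
have kX0 : 0 <= (2 * m.+1)%:R * alpha * enorm x ^+ (2 * m) by nonneg.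
rewrite normrM (ger0_norm kX0).
apply: (@le_trans _ _ ((2 * m.+1)%:R * alpha * enorm x ^+ (2 * m) * (enorm x * Cv))).
  rewrite ler_wpM2l//.
  by rewrite (le_trans (cauchy_schwarz x v))// ler_wpM2l.
have -> : enorm x ^+ (2 * m.+1) = enorm x * enorm x ^+ (2 * m).+1.
  by rewrite -exprS mulnS.
have -> : (2 * m.+1)%:R * alpha * enorm x ^+ (2 * m) * (enorm x * Cv) =
  B * alpha * enorm x ^+ (2 * m).+1 / 2 by rewrite /B [in RHS]exprS; field.
have rm0 : 0 <= enorm x ^+ (2 * m).+1 by exact: exprn_ge0.
have Ba0 : 0 <= B * alpha by rewrite mulr_ge0// ltW.
have [h|/ltW h] := leP (B * alpha) (enorm x).
  rewrite -[leLHS]addr0; apply: lerD; last by nonneg.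
  by rewrite ler_wpM2r ?invr_ge0// ler_wpM2r.
rewrite -[leLHS]add0r; apply: lerD; first by nonneg.
apply: (@le_trans _ _ (B * alpha * enorm x ^+ (2 * m).+1)).
  by rewrite ler_pdivrMr//; apply: ler_peMr; [nonneg|rewrite ler1n].
apply: (@le_trans _ _ ((B * alpha) ^+ (2 * m.+1))).
  rewrite mulnS [leRHS]exprS ler_wpM2l// lerXn2r ?nnegrE//.
rewrite exprMn ler_wpM2l ?exprn_ge0//; apply: ler_wiXn2l => //; first exact: ltW.
by rewrite mulnS mul2n -addnn !addSn !ltnS leq_addr.
Qed.

(** Pathwise drift. In the application x = D_k, [G] and [gb] are g(theta_k, X_{k+1}) and
    gbar(theta_k), [u] and [v'] are the Poisson solution and its image at (theta_k, X_{k+1}), [v] is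
    that image at (theta_k, X_k), and [v1] at (theta_{k+1}, X_{k+1}). Replacing [G - gb] by [u - v']
    and adding the increment of the corrector leaves [u - v], the martingale part, and [v1 - v'],
    the Hoelder error. *)
Lemma lyapunov_drift (p m : nat) (mu L Cv Ch eta : R) : (m < p)%N ->
  0 <= L -> 0 <= Cv -> 0 <= Ch -> 0 < eta ->
  exists C alpha0, [/\ 0 <= C, 0 < alpha0 <= 1 &
    forall alpha x (G xi gb u v v' v1 : 'rV[R]_d),
    0 < alpha < alpha0 ->
    edot x gb <= - mu * enorm x ^+ 2 ->
    enorm G <= L * (1 + enorm x) ->
    enorm (G - gb - (u - v')) <= alpha ->
    enorm v1 <= Cv ->
    enorm (v1 - v') <= Ch * Num.sqrt (enorm (alpha *: (G + xi))) ->
    lyapunov m alpha (x + alpha *: (G + xi)) v1 <=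
      lyapunov m alpha x v -
      (2 * m.+1)%:R * alpha * mu * enorm x ^+ (2 * m.+1) +
      (2 * m.+1)%:R * alpha * (enorm x ^+ (2 * m) * edot x (xi + u - v)) +
      (eta * alpha * enorm x ^+ (2 * m.+1) + C * alpha ^+ m.+2) *
        (1 + (enorm xi / (1 + enorm x)) ^+ (2 * p))].
Proof.
move=> mp L0 Cv0 Ch0 eta0.
have [C1 C10 taylor] := @enorm_expr_taylor R d m.
pose k := (2 * m.+1)%:R : R; have k0 : 0 <= k by exact: ler0n.
have [C [alpha0 [C0 a01 err]]] :=
  @lyapunov_scalar_error R p m k (k * Ch) C1 (k * (1 + (2 * m)%:R) * Cv) L eta
  mp k0 (mulr_ge0 k0 Ch0) C10 (mulr_ge0 (mulr_ge0 k0 (addr_ge0 ler01 (ler0n _ _))) Cv0)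
  L0 eta0.
exists C, alpha0; split => // alpha x G xi gb u v v' v1 al hgb hG he hv1 hv.
have al0 : 0 < alpha by case/andP: al.
set y := alpha *: (G + xi).
have r0 := enorm_ge0 x; have a0 := enorm_ge0 y.
have ay : 0 <= enorm y <= alpha * (L * (1 + enorm x) + enorm xi).
  rewrite enorm_ge0/= enormZ gtr0_norm// ler_pM2l//.
  by rewrite (le_trans (enormD _ _))// lerD2r.
have {}err := err alpha (enorm x) (enorm xi) (enorm y) al r0 (enorm_ge0 xi) ay.
apply: le_trans _ (lerD (lexx _) err) => {err}.
have {}taylor := taylor x y.
rewrite /lyapunov -/k; set N := enorm x ^+ (2 * m.+1) in taylor *.
have M0 : 0 <= enorm x ^+ (2 * m) by exact: exprn_ge0.
have rM : enorm x ^+ (2 * m).+1 = enorm x ^+ (2 * m) * enorm x by rewrite exprSr.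
have NM : N = enorm x ^+ (2 * m) * enorm x ^+ 2.
  by rewrite /N -exprD mulnS addnC.
have diff := enorm_expr_diff (2 * m) x y.
have S0 : 0 <= (enorm x + enorm y) ^+ (2 * m) by rewrite exprn_ge0// addr_ge0.
(* Moving the corrector from x to x + y changes the vector, at cost |y| Cv, and the weight, at cost
   2m |y| Cv by the mean value bound. *)
have hw : enorm (x + y) ^+ (2 * m) * edot (x + y) v1 <=
    enorm x ^+ (2 * m) * edot x v1 +
    (1 + (2 * m)%:R) * Cv * enorm y * (enorm x + enorm y) ^+ (2 * m).
  rewrite edotDl.
  have p1 : enorm (x + y) ^+ (2 * m) <= (enorm x + enorm y) ^+ (2 * m).
    by rewrite lerXn2r ?nnegrE ?enorm_ge0 ?addr_ge0// enormD.
  have e1 : `|edot x v1| <= enorm x * Cv.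
    by rewrite (le_trans (cauchy_schwarz _ _))// ler_wpM2l.
  have e2 : edot y v1 <= enorm y * Cv.
    by rewrite (le_trans (edot_le _ _))// ler_wpM2l.
  have p10 : 0 <= enorm (x + y) ^+ (2 * m) by rewrite exprn_ge0// enorm_ge0.
  have h1 : enorm (x + y) ^+ (2 * m) * edot y v1 <=
      (enorm x + enorm y) ^+ (2 * m) * (enorm y * Cv).
    apply: le_trans (ler_wpM2l p10 e2) _.
    by rewrite ler_wpM2r// mulr_ge0.
  have h2 : (enorm (x + y) ^+ (2 * m) - enorm x ^+ (2 * m)) * edot x v1 <=
      (2 * m)%:R * enorm y * (enorm x + enorm y) ^+ (2 * m) * Cv.
    apply: le_trans (ler_norm _) _; rewrite normrM.
    apply: le_trans (ler_wpM2l (normr_ge0 _) e1) _.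
    rewrite mulrA ler_wpM2r//; apply: le_trans diff.
    by rewrite ler_wpM2l// lerDl.
  by lra.
have he' : edot x (G - gb - (u - v')) <= enorm x * alpha.
  by rewrite (le_trans (edot_le _ _))// ler_wpM2l.
have hv' : edot x (v1 - v') <= enorm x * (Ch * Num.sqrt (enorm y)).
  by rewrite (le_trans (edot_le _ _))// ler_wpM2l.
have ka : 0 <= k * alpha by rewrite mulr_ge0// ltW.
have hw' := ler_wpM2l ka hw.
have kaM : 0 <= k * alpha * enorm x ^+ (2 * m) by rewrite mulr_ge0.
have he'' := ler_wpM2l kaM he'.
have hv'' := ler_wpM2l kaM hv'.
have hgb' := ler_wpM2l kaM hgb.
rewrite edotZr edotDr in taylor.
rewrite !edotBr in he'' hv''; rewrite edotBr edotDr rM.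
move: taylor hw' he'' hv'' hgb'; rewrite -/k NM.
move: (edot x G) (edot x xi) (edot x gb) (edot x u) (edot x v) (edot x v') (edot x v1).
move=> xG xxi xgb xu xv xv' xv1.
move: (enorm x ^+ (2 * m)) ((enorm x + enorm y) ^+ (2 * m)) => X S.
move: (enorm (x + y) ^+ (2 * m.+1)) => A.
move: (edot (x + y) v1) (enorm (x + y) ^+ (2 * m)).
move: (enorm x) (enorm y) (Num.sqrt (enorm y)) => r a sa e A'.
by lra.
Qed.

End lyapunov.

(** * Lipschitz functions and the Wasserstein distance *)

Section borel.
Context {R : realType}.

Lemma continuous_borel_measurable (T : ptopologicalType) (f : T -> R) :
  continuous f -> measurable_fun [set: borel T] (f : borel T -> R).
Proof.
move=> /continuousP cf; apply: (measurability _ (RGenOpens.measurableE R)).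
move=> _ [_ [a [b ->] <-]]; rewrite setTI.
by apply: sub_sigma_algebra; exact/cf/interval_open.
Qed.

(** A nonnegative integral is a supremum over the simple functions below the integrand, so
    monotonicity holds for arbitrary functions. It is applied to the squared metric on the product
    space. *)
Lemma le_integral_ge0 d (T : measurableType d)
    (mu : {measure set T -> \bar R}) (f g : T -> \bar R) :
  (forall x, (0 <= f x)%E) -> (forall x, (f x <= g x)%E) ->
  (\int[mu]_x f x <= \int[mu]_x g x)%E.
Proof.
move=> f0 fg; have g0 x : (0 <= g x)%E := le_trans (f0 x) (fg x).
rewrite !ge0_integralTE//; apply: le_ereal_sup => _ [h hf <-].
by exists h => // x; exact: le_trans (hf x) (fg x).
Qed.

Section bounded.
Context d (T : measurableType d) (mu : {measure set T -> \bar R}).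
Hypothesis mu1 : (mu setT = 1)%E.

Lemma bounded_le_integrable (f : T -> R) (M : R) : measurable_fun setT f ->
  (forall x, `|f x| <= M) -> mu.-integrable setT (EFin \o f).
Proof.
move=> mf fM; apply: measurable_bounded_integrable => //; first by rewrite mu1 ltry.
exists M; split; first exact: num_real.
by move=> N MN x _ /=; exact: le_trans (fM x) (ltW MN).
Qed.

Lemma Rintegral_probability_cst (c : R) : \int[mu]_x (cst c x) = c.
Proof. by rewrite Rintegral_cst// mu1 mulr1. Qed.

Lemma integrable_probability_cst (c : R) :
  mu.-integrable setT (EFin \o cst c).
Proof. by apply: (@bounded_le_integrable _ `|c|) => //; exact: measurable_cst. Qed.

(** Jensen for the square: expand the nonnegative integral of (f - c)^2, with c the mean of f. *)
Lemma sqr_Rintegral_le (f : T -> R) (M : R) : measurable_fun setT f ->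
  (forall x, `|f x| <= M) ->
  (\int[mu]_x f x) ^+ 2 <= \int[mu]_x (f x ^+ 2).
Proof.
move=> mf fM; set c := \int[mu]_x f x.
have M0 : 0 <= M := le_trans (normr_ge0 _) (fM point).
have f1 := @bounded_le_integrable _ _ mf fM.
have mf2 : measurable_fun setT (fun x => f x ^+ 2) by exact: measurable_funX.
have f2 : mu.-integrable setT (EFin \o (fun x => f x ^+ 2)).
  apply: (@bounded_le_integrable _ (M ^+ 2)) => // x.
  by rewrite normrX lerXn2r ?nnegrE.
have mc : measurable_fun setT (fun x => (2 * c) * f x).
  by apply: measurable_funM => //; exact: measurable_cst.
have f3 : mu.-integrable setT (EFin \o (fun x => (2 * c) * f x)).
  apply: (@bounded_le_integrable _ (`|2 * c| * M)) => // x.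
  by rewrite normrM ler_wpM2l.
have f4 : mu.-integrable setT (EFin \o (fun x => f x ^+ 2 - (2 * c) * f x)).
  by have := integrableB measurableT f2 f3; apply: eq_integrable.
have : 0 <= \int[mu]_x (f x ^+ 2 - (2 * c) * f x + cst (c ^+ 2) x).
  apply: Rintegral_ge0 => x _ /=.
  by have := sqr_ge0 (f x - c); rewrite sqrrB; lra.
rewrite RintegralD//; last exact: integrable_probability_cst.
rewrite RintegralB// RintegralZl// Rintegral_probability_cst -/c; lra.
Qed.

End bounded.
End borel.

Section lipschitz.
Context {R : realType} {X : pointedMetricType R}.
Hypothesis cX : compact [set: X].

Definition lip (L : R) (f : X -> R) := forall x y, `|f x - f y| <= L * mdist x y.

Lemma lip_continuous (L : R) (f : X -> R) : lip L f -> continuous f.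
Proof.
move=> Lf x; apply/cvgrPdist_lt => e e0.
pose M := `|L| + 1; have M0 : 0 < M by rewrite /M ltr_wpDl.
have : nbhs x (ball x (e / M)) by apply: nbhsx_ballx; rewrite divr_gt0.
apply: filterS => y; rewrite ballEmdist /= ltr_pdivlMr// mulrC => h.
apply: le_lt_trans (Lf x y) _; apply: le_lt_trans h.
by rewrite ler_wpM2r ?mdist_ge0// /M (le_trans (ler_norm L))// lerDl.
Qed.

Lemma lip_measurable (L : R) (f : X -> R) : lip L f ->
  measurable_fun [set: borel X] (f : borel X -> R).
Proof. by move=> Lf; apply: continuous_borel_measurable; exact: lip_continuous Lf. Qed.

Lemma lip_mdist (c : X) : lip 1 (mdist c).
Proof.
move=> x y; rewrite mul1r ler_norml lerBlDr.
have h1 := metric_triangle c x y; have h2 := metric_triangle c y x.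
by rewrite (metric_sym y x) in h2; apply/andP; split; lra.
Qed.

Lemma open_mdist_lt (c : X) (e : R) : open [set y | mdist c y < e].
Proof.
have /continuousP h := lip_continuous _ _ (lip_mdist c).
exact: (h _ (@open_lt _ e)).
Qed.

Lemma compact_diameter : exists2 D : R, 0 <= D & forall x y : X, mdist x y <= D.
Proof.
have lf := @lip_mdist point.
have : bounded_set ((fun x : X => mdist point x) @` [set: X]).
  apply: compact_bounded; apply: continuous_compact => //.
  by apply: continuous_subspaceT; exact: lip_continuous lf.
move=> [M [_ HM]].
have hM x : mdist (point : X) x <= `|M| + 1.
  apply: le_trans (ler_norm _) _; apply: (HM (`|M| + 1)); last by exists x.
  by rewrite (le_lt_trans (ler_norm M))// ltrDl.
exists (2 * (`|M| + 1)); first by rewrite mulr_ge0// addr_ge0.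
move=> x y; have := metric_triangle x point y; rewrite (metric_sym x point).
have := hM x; have := hM y; lra.
Qed.

Lemma lip_bounded (L : R) (f : X -> R) : lip L f ->
  exists M, forall x, `|f x| <= M.
Proof.
move=> Lf; have [D D0 HD] := compact_diameter.
exists (`|f point| + `|L| * D) => x.
have -> : f x = f point + (f x - f point) by rewrite addrC subrK.
apply: le_trans (ler_normD _ _) _; rewrite lerD2l.
apply: le_trans (Lf x point) _; apply: (@le_trans _ _ (`|L| * mdist x point)).
  by rewrite ler_wpM2r ?mdist_ge0// ler_norm.
by rewrite ler_wpM2l.
Qed.

Lemma lip_integrable (mu : {measure set (borel X) -> \bar R}) (L : R) (f : X -> R) :
  (mu setT = 1)%E -> lip L f -> mu.-integrable setT (EFin \o (f : borel X -> R)).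
Proof.
move=> mu1 Lf; have [M fM] := @lip_bounded _ _ Lf.
exact: (@bounded_le_integrable _ _ _ mu mu1 f M (@lip_measurable _ _ Lf) fM).
Qed.

(** [coupling] prescribes the measure of cylinders, that is, the pushforwards of [gamma] by the two
    projections. *)
Lemma coupling_Rintegral (mu nu : {measure set (borel X) -> \bar R})
    (gamma : probability (borel X * borel X)%type R) (L : R) (f : X -> R) :
  coupling mu nu gamma -> lip L f ->
  \int[gamma]_z (f z.1) = \int[mu]_x (f x : R) /\
  \int[gamma]_z (f z.2) = \int[nu]_x (f x : R).
Proof.
move=> cg Lf; have [M fM] := @lip_bounded _ _ Lf.
have mf := @lip_measurable _ _ Lf.
have mEf : measurable_fun [set: borel X] (EFin \o (f : borel X -> R)).
  exact/measurable_EFinP.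
split; rewrite /Rintegral; congr fine.
- transitivity (\int[pushforward gamma fst]_x (EFin \o (f : borel X -> R)) x)%E.
    rewrite integral_pushforward//.
    apply: (@bounded_le_integrable _ _ _ gamma _ (f \o fst) M) => //.
    + exact: probability_setT.
    + exact: (measurableT_comp mf measurable_fst).
    + by move=> x; exact: fM.
  apply: eq_measure_integral => A mA _.
  by rewrite /pushforward -(cg A mA).1; congr (gamma _); apply/seteqP; split => z //= [].
- transitivity (\int[pushforward gamma snd]_x (EFin \o (f : borel X -> R)) x)%E.
    rewrite integral_pushforward//.
    apply: (@bounded_le_integrable _ _ _ gamma _ (f \o snd) M) => //.
    + exact: probability_setT.
    + exact: (measurableT_comp mf measurable_snd).
    + by move=> x; exact: fM.
  apply: eq_measure_integral => A mA _.
  by rewrite /pushforward -(cg A mA).2; congr (gamma _); apply/seteqP; split => z //= [].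
Qed.

(** Removes the power 1/2, so that a bound proved for every coupling passes to the infimum and no
    optimal coupling has to be produced. *)
Lemma W2_le_sqr (mu nu : {measure set (borel X) -> \bar R}) (w : R) : 0 <= w ->
  (W2 mu nu <= w%:E)%E ->
  (ereal_inf [set \int[gamma]_z ((mdist (z.1 : X) (z.2 : X)) ^+ 2)%:E |
    gamma in coupling mu nu] <= (w ^+ 2)%:E)%E.
Proof.
rewrite /W2 => w0; set I := ereal_inf _.
have I0 : (0 <= I)%E.
  apply: le_ereal_inf_tmp => _ [g _ <-]; apply: integral_ge0 => z _.
  by rewrite lee_fin sqr_ge0.
rewrite poweR12_sqrt//; case: I I0 => [r| |] //=.
rewrite !lee_fin => r0 h; rewrite -(sqr_sqrtr r0).
by rewrite lerXn2r ?nnegrE ?sqrtr_ge0.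
Qed.

(* Kantorovich-Rubinstein with the cheap half of duality: integrate
   [f z.1 - f z.2] against a coupling and apply Jensen. *)
Lemma W2_lip (mu nu : {measure set (borel X) -> \bar R}) (L w : R) (f : X -> R) :
  (mu setT = 1)%E -> (nu setT = 1)%E -> 0 <= L -> 0 <= w -> lip L f ->
  (W2 mu nu <= w%:E)%E ->
  `|\int[mu]_x (f x : R) - \int[nu]_x (f x : R)| <= L * w.
Proof.
move=> mu1 nu1 L0 w0 Lf; move=> /(@W2_le_sqr _ _ _ w0) hw.
(* For [L = 0] the function is constant; otherwise both sides are divided by [L]. *)
have [L0'|L0'] := ltrP 0 L; last first.
  have fc : f = cst (f point).
    apply/funext => x; apply/eqP; rewrite -subr_eq0 -normr_le0.
    by rewrite (le_trans (Lf x point))// mulr_le0_ge0// mdist_ge0.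
  rewrite fc !Rintegral_probability_cst// subrr normr0 mulr_ge0//.
set D := _ - _.
suff : (((D / L) ^+ 2)%:E <= (w ^+ 2)%:E)%E.
  rewrite lee_fin -[_ ^+ 2]real_normK ?num_real// ler_sqr ?nnegrE//.
  by rewrite normrM normfV (gtr0_norm L0') ler_pdivrMr// mulrC.
apply: le_trans hw; apply: le_ereal_inf_tmp => _ [gamma cg <-].
have [e1 e2] := @coupling_Rintegral _ _ _ _ _ cg Lf.
have [M fM] := @lip_bounded _ _ Lf.
have mf := @lip_measurable _ _ Lf.
have g1 : gamma setT = 1%E by exact: probability_setT.
have mf1 : measurable_fun [set: (borel X * borel X)%type] (fun z => f z.1).
  exact: (measurableT_comp mf measurable_fst).
have mf2 : measurable_fun [set: (borel X * borel X)%type] (fun z => f z.2).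
  exact: (measurableT_comp mf measurable_snd).
have if1 : gamma.-integrable setT (EFin \o (fun z => f z.1)).
  by apply: (@bounded_le_integrable _ _ _ gamma g1 _ M).
have if2 : gamma.-integrable setT (EFin \o (fun z => f z.2)).
  by apply: (@bounded_le_integrable _ _ _ gamma g1 _ M).
pose h z := (f z.1 - f z.2) * L^-1.
have mh : measurable_fun [set: (borel X * borel X)%type] h.
  apply: measurable_funM; last exact: measurable_cst.
  exact: measurable_funB.
have hM z : `|h z| <= (M + M) * L^-1.
  rewrite normrM normfV (gtr0_norm L0') ler_wpM2r ?invr_ge0//.
  by rewrite (le_trans (ler_normB _ _))// lerD.
have -> : D / L = \int[gamma]_z h z.
  rewrite /h RintegralZr//.
    by rewrite RintegralB// e1 e2.
  by have := integrableB measurableT if1 if2; apply: eq_integrable.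
apply: (@le_trans _ _ (\int[gamma]_z (h z ^+ 2))%:E).
  by rewrite lee_fin; exact: (@sqr_Rintegral_le _ _ _ gamma g1 h _ mh hM).
rewrite fineK; last first.
  apply: integrable_fin_num => //.
  apply: (@bounded_le_integrable _ _ _ gamma g1 (fun z => h z ^+ 2) (((M + M) / L) ^+ 2)).
    exact: measurable_funX.
  by move=> z; rewrite normrX lerXn2r ?nnegrE// (le_trans _ (hM z)).
apply: le_integral_ge0 => z; rewrite lee_fin ?sqr_ge0//.
rewrite -[leLHS]real_normK ?num_real// lerXn2r ?nnegrE ?mdist_ge0//.
by rewrite normrM normfV (gtr0_norm L0') ler_pdivrMr// mulrC Lf.
Qed.

End lipschitz.

(** * Integrals of random functions against random measures *)

Section mixture.
Context {R : realType} {X : pointedMetricType R}.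
Hypothesis cX : compact [set: X].

Lemma find_measurable (e : R) (s : seq X) (i : nat) :
  measurable [set y : borel X | find (fun c : X => mdist c y < e) s = i].
Proof.
elim: s i => [|c s IH] i /=.
  have [<-|/eqP i0] := eqVneq 0%N i.
    by rewrite (_ : [set _ | _] = setT)//; apply/seteqP; split.
  by rewrite (_ : [set _ | _] = set0)//; apply/seteqP; split.
have mb : measurable ([set y | mdist c y < e] : set (borel X)).
  by apply: sub_sigma_algebra; exact: open_mdist_lt.
case: i => [|i].
  rewrite (_ : [set _ | _] = [set y | mdist c y < e])//.
  by apply/seteqP; split => y /=; case: ifP.
rewrite (_ : [set _ | _] = [set y : borel X | find (fun c => mdist c y < e) s = i] `\`
  [set y | mdist c y < e]); first exact: measurableD.
apply/seteqP; split => y /=.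
  by case: ifP => // h [->]; split => //; rewrite h.
by case=> -> /negP/negbTE ->.
Qed.

(** A finite subcover by balls is made disjoint by sending a point to the first ball containing it;
    [find] performs this choice. *)
Lemma finite_partition (e : R) : 0 < e -> exists (n : nat) (c : nat -> X)
    (idx : X -> nat),
  [/\ forall i, measurable [set y : borel X | idx y = i],
      forall y, (idx y < n)%N & forall y, mdist y (c (idx y)) < e].
Proof.
move=> e0; move: cX; rewrite compact_cover => /(_ _ setT (fun c : X => ball c e)).
case.
- by move=> i _; rewrite ballEmdist; exact: open_mdist_lt.
- by move=> x _; exists x => //; exact: ballxx.
move=> D _ cov; pose s := finmap.enum_fset D.
have hs y : has (fun c : X => mdist c y < e) s.
  have [c cD] := cov y I; rewrite ballEmdist => /= h.
  by apply/hasP; exists c.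
exists (size s), (nth point s), (fun y => find (fun c : X => mdist c y < e) s).
split=> [i|y|y]; first exact: find_measurable.
  by rewrite -has_find.
by rewrite metric_sym; exact: (nth_find point (hs y)).
Qed.

Section quantize.
Context d (T : measurableType d).
Variables (F : T -> X -> R) (L : R).
Hypothesis FL : forall w, lip L (F w).
Variables (n : nat) (c : nat -> X) (idx : X -> nat) (e : R).
Hypothesis midx : forall i, measurable [set y : borel X | idx y = i].
Hypothesis idxn : forall y, (idx y < n)%N.
Hypothesis cidx : forall y, mdist y (c (idx y)) < e.

Let cell i : set (borel X) := [set y | idx y = i].

(** A Riemann sum for the integral of [F w] against [Q w]: it sees the random measure only through
    the masses of finitely many fixed cells. *)
Definition quantized (Q : T -> {measure set (borel X) -> \bar R}) (w : T) : R :=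
  \sum_(i < n) F w (c i) * fine (Q w (cell i)).

Lemma quantized_dist (Q : T -> {measure set (borel X) -> \bar R}) w :
  0 <= L -> (Q w setT = 1)%E ->
  `|\int[Q w]_y (F w y : R) - quantized Q w| <= L * e.
Proof.
move=> L0 Q1.
have e0 : 0 < e by exact: le_lt_trans (mdist_ge0 _ _) (cidx point).
have iF := @lip_integrable _ _ cX (Q w) L _ Q1 (FL w).
pose S (y : borel X) := \sum_(i < n) F w (c i) * \1_(cell i) y.
have SE y : S y = F w (c (idx y)).
  rewrite /S (bigD1 (Ordinal (idxn y)))//= indicE mem_set// mulr1 big1 ?addr0//.
  move=> j jn; rewrite indicE memNset ?mulr0// /cell/= => h.
  by move: jn; rewrite -val_eqE /= h eqxx.
have iI i : (Q w).-integrable setT (EFin \o (fun y => F w (c i) * \1_(cell i) y)).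
  apply: (@bounded_le_integrable _ _ _ (Q w) Q1 _ `|F w (c i)|).
    apply: measurable_funM; first exact: measurable_cst.
    by apply: measurable_indic; exact: midx.
  move=> y; rewrite normrM ler_piMr// indicE; case: (_ \in _) => /=.
    by rewrite normr1.
  by rewrite normr0.
have qE : \int[Q w]_y S y = quantized Q w.
  rewrite /Rintegral /S; under eq_integral do rewrite -sumEFin.
  rewrite integral_sum//; last by move=> i; exact: iI.
  rewrite /quantized; rewrite -[RHS]/(fine (\sum_(i < n) F w (c i) * fine (Q w (cell i)))%:E).
  congr fine; rewrite -sumEFin; apply: eq_bigr => i _.
  under eq_integral do rewrite EFinM.
  rewrite integralZl//; last first.
    apply: (@bounded_le_integrable _ _ _ (Q w) Q1 (\1_(cell i)) 1).
      by apply: measurable_indic; exact: midx.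
    by move=> y; rewrite indicE; case: (_ \in _); rewrite /= ?normr1 ?normr0.
  rewrite (integral_indic _ measurableT (midx i)) setIT EFinM fineK// ge0_fin_numE//.
  apply: (@le_lt_trans _ _ (Q w setT)); last by rewrite Q1 ltry.
  by apply: le_measure; rewrite ?inE//; exact: midx.
have iS : (Q w).-integrable setT (EFin \o S).
  rewrite (_ : _ \o _ = fun y => (\sum_(i < n) (F w (c i) * \1_(cell i) y)%:E)%E).
    by apply: integrable_sum => // i _; exact: iI.
  by apply/funext => y; rewrite /= sumEFin.
rewrite -qE -RintegralB//.
have iD : (Q w).-integrable setT (EFin \o (fun y => F w y - S y)).
  by have := integrableB measurableT iF iS; apply: eq_integrable.
apply: le_trans; first exact: le_normr_Rintegral.
rewrite -[leRHS](@Rintegral_probability_cst _ _ _ (Q w) Q1).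
apply: le_Rintegral => //.
- by have := integrable_norm iD; apply: eq_integrable.
- exact: integrable_probability_cst.
- move=> y _; rewrite SE; apply: le_trans (FL w _ _) _.
  by rewrite ler_wpM2l// ltW.
Qed.

Lemma quantized_measurable (Q : T -> {measure set (borel X) -> \bar R}) :
  (forall A, measurable A -> measurable_fun setT (fun w => fine (Q w A))) ->
  (forall y, measurable_fun setT (F^~ y)) ->
  measurable_fun setT (quantized Q).
Proof.
move=> mQ mF; apply: measurable_sum => i; apply: measurable_funM => //.
by apply: mQ; exact: midx.
Qed.

End quantize.

Section random_measure.
Context d (T : measurableType d) (mu : {measure set T -> \bar R}).
Hypothesis mu1 : (mu setT = 1)%E.
Variables (F : T -> X -> R) (L M : R).
Hypothesis FL : forall w, lip L (F w).
Hypothesis L0 : 0 <= L.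
Hypothesis mF : forall y, measurable_fun setT (F^~ y).

(** Pointwise limit of quantized sums of mesh 1/(k+1), each a finite sum of products of measurable
    functions of w. *)
Lemma Rintegral_random_measurable (Q : T -> {measure set (borel X) -> \bar R}) :
  (forall w, (Q w setT = 1)%E) ->
  (forall A, measurable A -> measurable_fun setT (fun w => fine (Q w A))) ->
  measurable_fun setT (fun w => \int[Q w]_y (F w y : R)).
Proof.
move=> Q1 mQ.
have part k := @finite_partition k.+1%:R^-1 (ltac:(by rewrite invr_gt0 ltr0n)).
pose q k := projT1 (cid (part k)); pose c k := projT1 (cid (projT2 (cid (part k)))).
pose idx k := projT1 (cid (projT2 (cid (projT2 (cid (part k)))))).
have hq k : [/\ forall i, measurable [set y : borel X | idx k y = i],
      forall y, (idx k y < q k)%N & forall y, mdist y (c k (idx k y)) < k.+1%:R^-1].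
  exact: projT2 (cid (projT2 (cid (projT2 (cid (part k)))))).
apply: (@measurable_fun_cvg _ _ _ _ (fun k => @quantized _ T F (q k) (c k) (idx k) Q)).
- move=> k; have [h1 h2 h3] := hq k.
  exact: quantized_measurable.
- move=> w _; apply/cvgrPdist_le => e e0.
  near=> k; have [h1 h2 h3] := hq k.
  apply: le_trans (@quantized_dist _ _ _ _ FL _ _ _ _ h1 h2 h3 Q w L0 (Q1 w)) _.
  rewrite ler_pdivrMr ?ltr0n// mulrC -ler_pdivrMr//.
  apply: (@le_trans _ _ k%:R); last by rewrite ler_nat.
  by near: k; exact: nbhs_infty_ger.
Unshelve. all: by end_near. Qed.

(** Passes from sets to integrands that depend on w and y together. The averaged integrals against
    [Q] and [S] are each within [L] times the mesh of a finite sum over cells, and these two sums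
    coincide. It serves for invariance, with [S] constant, and for the conditional law of X_{k+1},
    with [S] a Dirac mass. *)
Lemma Rintegral_random_eq (Q S : T -> {measure set (borel X) -> \bar R}) :
  (forall w y, `|F w y| <= M) ->
  (forall w, (Q w setT = 1)%E) -> (forall w, (S w setT = 1)%E) ->
  (forall A, measurable A -> measurable_fun setT (fun w => fine (Q w A))) ->
  (forall A, measurable A -> measurable_fun setT (fun w => fine (S w A))) ->
  (forall A y, measurable A -> \int[mu]_w (F w y * fine (Q w A)) =
     \int[mu]_w (F w y * fine (S w A))) ->
  \int[mu]_w (\int[Q w]_y (F w y : R)) = \int[mu]_w (\int[S w]_y (F w y : R)).
Proof.
move=> FM Q1 S1 mQ mS QS.
have M0 : 0 <= M := le_trans (normr_ge0 _) (FM point point).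
have Q01 (N : T -> {measure set (borel X) -> \bar R}) w A :
    (forall w, (N w setT = 1)%E) -> measurable A -> 0 <= fine (N w A) <= 1.
  move=> N1 mA; rewrite fine_ge0//=.
  have h : (N w A <= 1)%E by rewrite -(N1 w); apply: le_measure; rewrite ?inE.
  by rewrite -lee_fin fineK// ge0_fin_numE// (le_lt_trans h)// ltry.
have close (N : T -> {measure set (borel X) -> \bar R}) n c idx e :
    (forall w, (N w setT = 1)%E) ->
    (forall A, measurable A -> measurable_fun setT (fun w => fine (N w A))) ->
    (forall i, measurable [set y : borel X | idx y = i]) ->
    (forall y, (idx y < n)%N) -> (forall y, mdist y (c (idx y)) < e) ->
  `|\int[mu]_w (\int[N w]_y (F w y : R)) -
    \sum_(i < n) \int[mu]_w (F w (c i) * fine (N w [set y : borel X | idx y = i]))|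
    <= L * e.
  move=> N1 mN h1 h2 h3.
  have iI i : mu.-integrable setT (EFin \o
      (fun w => F w (c i) * fine (N w [set y : borel X | idx y = i]))).
    apply: (@bounded_le_integrable _ _ _ mu mu1 _ M).
      by apply: measurable_funM => //; exact: mN.
    move=> w; have /andP[a0 a1] := Q01 N w _ N1 (h1 i).
    by rewrite normrM (ger0_norm a0) (le_trans _ (FM w (c i)))// ler_piMr.
  have qE : \sum_(i < n) \int[mu]_w (F w (c i) * fine (N w [set y : borel X | idx y = i]))
    = \int[mu]_w (quantized _ _ F n c idx N w).
    rewrite [in RHS]/Rintegral /quantized; under [in RHS]eq_integral do rewrite -sumEFin.
    rewrite integral_sum//; last by move=> i; exact: iI.
    rewrite -[LHS]/(fine (\sum_(i < n) _)%:E); congr fine.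
    rewrite -sumEFin; apply: eq_bigr => i _; rewrite fineK//.
    by apply: integrable_fin_num => //; exact: iI.
  have mI := @Rintegral_random_measurable N N1 mN.
  have qd w := @quantized_dist _ _ F L FL _ _ _ _ h1 h2 h3 N w L0 (N1 w).
  have iNb w : `|\int[N w]_y (F w y : R)| <= M.
    have iF := @lip_integrable _ _ cX (N w) L _ (N1 w) (FL w).
    apply: le_trans; first exact: le_normr_Rintegral.
    rewrite -[leRHS](@Rintegral_probability_cst _ _ _ (N w) (N1 w)).
    apply: le_Rintegral => //.
    - by have := integrable_norm iF; apply: eq_integrable.
    - exact: integrable_probability_cst.
  have iN := @bounded_le_integrable _ _ _ mu mu1 _ M mI iNb.
  have iq : mu.-integrable setT (EFin \o quantized _ _ F n c idx N).
    rewrite (_ : _ \o _ = fun w => (\sum_(i < n)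
      (F w (c i) * fine (N w [set y : borel X | idx y = i]))%:E)%E).
      by apply: integrable_sum => // i _; exact: iI.
    by apply/funext => w; rewrite /= sumEFin.
  rewrite qE -RintegralB//.
  have iD : mu.-integrable setT (EFin \o
      (fun w => \int[N w]_y (F w y : R) - quantized _ _ F n c idx N w)).
    by have := integrableB measurableT iN iq; apply: eq_integrable.
  apply: le_trans; first exact: le_normr_Rintegral.
  rewrite -[leRHS](@Rintegral_probability_cst _ _ _ mu mu1).
  apply: le_Rintegral => //.
  - by have := integrable_norm iD; apply: eq_integrable.
  - exact: integrable_probability_cst.
apply/eqP; rewrite -subr_eq0 -normr_le0; apply/ler_addgt0Pl => e e0; rewrite addr0.
(* Mesh for which the two quantization errors add up to at most [e]; [L + 1] keeps it defined when
   [L = 0]. *)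
have e0' : 0 < e / (2 * (L + 1)) by rewrite divr_gt0// mulr_gt0// ltr_wpDl.
have [n [c [idx [h1 h2 h3]]]] := finite_partition _ e0'.
have cQ := close Q n c idx _ Q1 mQ h1 h2 h3.
have cS := close S n c idx _ S1 mS h1 h2 h3.
rewrite (eq_bigr (fun i : 'I_n => \int[mu]_w (F w (c i) *
  fine (S w [set y : borel X | idx y = i])))) in cQ; last by move=> i _; exact: QS.
rewrite distrC in cS; apply: le_trans (ler_distD _ _ _) _.
apply: le_trans (lerD cQ cS) _.
have : e / (2 * (L + 1)) * (2 * (L + 1)) = e.
  by rewrite divfK// gt_eqF// mulr_gt0// ltr_wpDl.
by move: e0'; move: (e / _) => t; lra.
Qed.

End random_measure.
End mixture.

(** * The truncated Poisson equation *)

Lemma sum_expr_le {R : realType} (q : R) (n : nat) : 0 <= q < 1 ->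
  \sum_(i < n) q ^+ i <= (1 - q)^-1.
Proof.
move=> /andP[q0 q1]; have q1' : 0 < 1 - q by rewrite subr_gt0.
rewrite -[leRHS]mul1r ler_pdivlMr// mulrC -[1 - q]opprB mulNr -subrX1 opprB.
by rewrite gerBl exprn_ge0.
Qed.

Section poisson.
Context {R : realType} {d : nat} {X : pointedMetricType R}.
Local Notation V := 'rV[R]_d.
Variables (K : V -> R.-pker (borel X) ~> (borel X)) (rho LP : R).
Hypothesis hK : kernel_contraction K rho LP.

Definition transition (theta : V) (h : X -> R) (x : X) : R :=
  \int[K theta x]_y (h y : R).

Let cX : compact [set: X] := ker_compact hK.
Let rho01 : 0 < rho <= 1 := ker_rho hK.
Let K1 theta x : (K theta x setT = 1)%E. Proof. exact: prob_kernel. Qed.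

Let rho0 : 0 < rho. Proof. by case/andP: rho01. Qed.
Let q0 : 0 <= 1 - rho. Proof. by case/andP: rho01; rewrite subr_ge0. Qed.
Let q1 : 1 - rho < 1. Proof. by rewrite gtrBl. Qed.

Lemma transition_lip theta (L : R) (h : X -> R) : 0 <= L -> lip L h ->
  lip (L * (1 - rho)) (transition theta h).
Proof.
move=> L0 Lh x y; rewrite -mulrA; apply: W2_lip => //.
- by rewrite mulr_ge0// mdist_ge0.
- exact: ker_contract hK _ _ _.
Qed.

Lemma transition_theta (L : R) (h : X -> R) theta theta' x : 0 <= L -> lip L h ->
  `|transition theta h x - transition theta' h x| <=
    L * (LP * enorm (theta - theta')).
Proof.
move=> L0 Lh; apply: W2_lip => //.
- by rewrite mulr_ge0 ?enorm_ge0// ltW// (ker_LP_gt0 hK).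
- exact: ker_lip hK _ _ _.
Qed.

Lemma transition_close theta (L L' c : R) (h h' : X -> R) x :
  lip L h -> lip L' h' -> (forall y, `|h y - h' y| <= c) ->
  `|transition theta h x - transition theta h' x| <= c.
Proof.
move=> Lh Lh' hh.
have ih := lip_integrable cX (K theta x) _ _ (K1 theta x) Lh.
have ih' := lip_integrable cX (K theta x) _ _ (K1 theta x) Lh'.
have iD : (K theta x).-integrable setT (EFin \o (fun y => h y - h' y)).
  by have := integrableB measurableT ih ih'; apply: eq_integrable.
rewrite /transition -RintegralB//.
apply: le_trans; first exact: le_normr_Rintegral.
rewrite -[leRHS](@Rintegral_probability_cst _ _ _ (K theta x) (K1 theta x)).
apply: le_Rintegral => //.
- by have := integrable_norm iD; apply: eq_integrable.
- exact/integrable_probability_cst/K1.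
Qed.

(** Invariance is stated on sets; [Rintegral_random_eq], with the constant random measure [nu] on
    one side, extends it to Lipschitz functions. *)
Lemma transition_invariant theta (nu : probability (borel X) R) (L : R)
    (h : X -> R) : 0 <= L -> lip L h -> invariant_law (K theta) nu ->
  \int[nu]_x transition theta h x = \int[nu]_x (h x : R).
Proof.
move=> L0 Lh inv.
have nu1 : nu setT = 1%E by exact: probability_setT.
have [M hM] := lip_bounded cX _ _ Lh.
have mK A : measurable A -> measurable_fun setT (fun w => fine (K theta w A)).
  by move=> mA; apply: measurableT_comp => //; exact: measurable_kernel.
have K01 w A : measurable A -> 0 <= fine (K theta w A) <= 1 /\
    K theta w A \is a fin_num.
  move=> mA; have h1 : (K theta w A <= 1)%E.
    by rewrite -(K1 theta w); apply: le_measure; rewrite ?inE.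
  have hf : K theta w A \is a fin_num by rewrite ge0_fin_numE// (le_lt_trans h1)// ltry.
  by rewrite fine_ge0//= -lee_fin fineK.
have := @Rintegral_random_eq _ _ cX _ _ nu nu1 (fun _ => h) L M (fun _ => Lh) L0
  (fun y => measurable_cst _) (fun w => K theta w) (fun _ => nu) (fun _ => hM)
  (K1 theta) (fun _ => nu1) mK.
rewrite /transition => ->.
- by rewrite (_ : (fun _ => _) = cst (\int[nu]_x (h x : R)))// Rintegral_probability_cst.
- by move=> A mA; exact: measurable_cst.
- move=> A y mA.
  have iK : nu.-integrable setT (EFin \o (fun w => fine (K theta w A))).
    apply: (@bounded_le_integrable _ _ _ nu nu1 _ 1); first exact: mK.
    by move=> w; have [/andP[? ?] _] := K01 w A mA; rewrite ger0_norm.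
  rewrite RintegralZl// [RHS](Rintegral_probability_cst _ _ nu nu1 (h y * _)).
  congr (_ * _).
  rewrite /Rintegral; congr fine; rewrite -[RHS](inv A mA); apply: eq_integral => w _.
  by rewrite fineK//; case: (K01 w A mA).
Qed.

Variables (f : V -> X -> R) (A : R).
Hypothesis A0 : 0 <= A.
Hypothesis fL : forall theta, lip A (f theta).
Hypothesis fT : forall theta theta' x,
  `|f theta x - f theta' x| <= A * enorm (theta - theta').
Hypothesis fC : forall theta, exists2 nu : probability (borel X) R,
  invariant_law (K theta) nu & \int[nu]_x (f theta x : R) = 0.

(** P_theta^j f_theta: the parameter enters both the operator and the function. *)
Definition iter_transition (j : nat) (theta : V) : X -> R :=
  iter j (transition theta) (f theta).

Let Aq j : 0 <= A * (1 - rho) ^+ j. Proof. by rewrite mulr_ge0// exprn_ge0. Qed.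

Lemma iter_transition_lip j theta :
  lip (A * (1 - rho) ^+ j) (iter_transition j theta).
Proof.
elim: j => [|j IH]; first by rewrite expr0 mulr1; exact: fL.
by rewrite exprSr mulrA; apply: transition_lip.
Qed.

(** Invariance keeps the mean under [nu] equal to 0, so the value at x is the mean of h(x) - h(y)
    over y; it is at most the Lipschitz constant A (1 - rho)^j times the diameter. *)
Lemma iter_transition_decay : exists2 D : R, 0 <= D &
  forall j theta x, `|iter_transition j theta x| <= A * D * (1 - rho) ^+ j.
Proof.
have [D D0 HD] := compact_diameter cX.
exists D => // j theta x; have [nu inv nu0] := fC theta.
have nu1 : nu setT = 1%E by exact: probability_setT.
have hl i := iter_transition_lip i theta.
have ih i := lip_integrable cX nu _ _ nu1 (hl i).
have z : \int[nu]_y (iter_transition j theta y : R) = 0.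
  elim: j => [|j IH]; first exact: nu0.
  by rewrite -[RHS]IH; exact: (transition_invariant _ _ _ _ (Aq j) (hl j) inv).
have -> : iter_transition j theta x =
    \int[nu]_y (iter_transition j theta x - iter_transition j theta y).
  rewrite RintegralB//; last exact: (integrable_probability_cst _ _ nu nu1).
  by rewrite z subr0 (Rintegral_probability_cst _ _ nu nu1).
have iD : nu.-integrable setT (EFin \o
    (fun y => iter_transition j theta x - iter_transition j theta y)).
  have := integrableB measurableT
    (integrable_probability_cst _ _ nu nu1 (iter_transition j theta x)) (ih j).
  by apply: eq_integrable.
apply: le_trans; first exact: le_normr_Rintegral.
rewrite -[leRHS](@Rintegral_probability_cst _ _ _ nu nu1).
apply: le_Rintegral => //.
- by have := integrable_norm iD; apply: eq_integrable.
- exact/integrable_probability_cst.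
- move=> y _; apply: le_trans (hl j x y) _.
  by rewrite [leRHS]mulrAC; apply: ler_wpM2l => //; exact: Aq.
Qed.

Let C := A + A * LP / rho.

(** One more application of the operator does not enlarge the previous difference, and changing the
    kernel costs LP times the current Lipschitz constant A (1 - rho)^j. These costs form a geometric
    series, so the bound is uniform in j but does not decay. *)
Lemma iter_transition_theta j theta theta' x :
  `|iter_transition j theta x - iter_transition j theta' x| <=
    C * enorm (theta - theta').
Proof.
pose s n := \sum_(i < n) (1 - rho) ^+ i.
have LP0 : 0 <= LP by rewrite ltW// (ker_LP_gt0 hK).
apply: (@le_trans _ _ ((A + A * LP * s j) * enorm (theta - theta'))); last first.
  rewrite ler_wpM2r ?enorm_ge0// /C lerD2l ler_wpM2l ?mulr_ge0//.
  have := @sum_expr_le _ (1 - rho) j.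
  rewrite (_ : 1 - (1 - rho) = rho); last by ring.
  apply.
  by rewrite q0 q1.
elim: j x => [|j IH] x.
  by rewrite /s big_ord0 mulr0 addr0; exact: fT.
rewrite /s big_ord_recr/= -/(s j).
have h1 : `|iter_transition j.+1 theta x - transition theta (iter_transition j theta') x|
    <= (A + A * LP * s j) * enorm (theta - theta').
  exact: transition_close (iter_transition_lip j theta) (iter_transition_lip j theta') IH.
have h2 : `|transition theta (iter_transition j theta') x - iter_transition j.+1 theta' x|
    <= A * (1 - rho) ^+ j * (LP * enorm (theta - theta')).
  exact: transition_theta (Aq j) (iter_transition_lip j theta').
apply: le_trans (ler_distD _ _ _) _; apply: le_trans (lerD h1 h2) _.
by rewrite le_eqVlt; apply/orP; left; apply/eqP; ring.
Qed.

(* Interpolating between the two previous bounds: the Poisson solution is only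
   log-Lipschitz in [theta], but it is 1/2-Hoelder, uniformly in the truncation. *)
Lemma iter_transition_hoelder : exists2 H : R, 0 <= H & forall j theta theta' x,
  `|iter_transition j theta x - iter_transition j theta' x| <=
    H * Num.sqrt (enorm (theta - theta')) * Num.sqrt (1 - rho) ^+ j.
Proof.
have [D D0 HD] := iter_transition_decay.
have C0 : 0 <= C.
  by rewrite /C addr_ge0// !mulr_ge0 ?invr_ge0// ltW// (ker_LP_gt0 hK).
exists (Num.sqrt (2 * (A * D) * C)); first exact: sqrtr_ge0.
move=> j theta theta' x.
have t0 := enorm_ge0 (theta - theta').
have h1 := iter_transition_theta j theta theta' x.
have h2 : `|iter_transition j theta x - iter_transition j theta' x| <=
    2 * (A * D) * (1 - rho) ^+ j.
  apply: le_trans (ler_normB _ _) _.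
  by have := HD j theta x; have := HD j theta' x; lra.
rewrite -ler_sqr ?nnegrE ?mulr_ge0 ?exprn_ge0 ?sqrtr_ge0//.
rewrite !exprMn sqr_sqrtr ?mulr_ge0// sqr_sqrtr// -exprM mulnC exprM sqr_sqrtr//.
have -> : 2 * (A * D) * C * enorm (theta - theta') * (1 - rho) ^+ j =
  2 * (A * D) * (1 - rho) ^+ j * (C * enorm (theta - theta')) by ring.
by rewrite expr2; apply: ler_pM.
Qed.

Definition poisson_sum (N : nat) (theta : V) (x : X) : R :=
  \sum_(j < N) iter_transition j theta x.

Lemma poisson_sum_lip N theta : lip (A / rho) (poisson_sum N theta).
Proof.
move=> x y; rewrite /poisson_sum -sumrB.
apply: le_trans (ler_norm_sum _ _ _) _.
apply: (@le_trans _ _ (\sum_(j < N) A * (1 - rho) ^+ j * mdist x y)).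
  by apply: ler_sum => j _; exact: iter_transition_lip.
rewrite -mulr_suml -mulr_sumr ler_wpM2r ?mdist_ge0// ler_wpM2l//.
have := @sum_expr_le _ (1 - rho) N.
rewrite (_ : 1 - (1 - rho) = rho); last by ring.
by apply; rewrite q0 q1.
Qed.

Lemma transition_poisson_sum N theta x :
  transition theta (poisson_sum N theta) x =
  \sum_(j < N) iter_transition j.+1 theta x.
Proof.
rewrite /transition /poisson_sum.
have iI j := lip_integrable cX (K theta x) _ _ (K1 theta x) (iter_transition_lip j theta).
rewrite /Rintegral; under eq_integral do rewrite -sumEFin.
rewrite integral_sum//; last by move=> j; exact: iI.
rewrite -[RHS]/(fine (\sum_(i < N) _)%:E); congr fine.
rewrite -sumEFin; apply: eq_bigr => j _; rewrite fineK//.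
by apply: integrable_fin_num => //; exact: iI.
Qed.

Lemma poisson_sumB N theta x :
  poisson_sum N theta x - transition theta (poisson_sum N theta) x =
  f theta x - iter_transition N theta x.
Proof.
rewrite transition_poisson_sum /poisson_sum.
elim: N => [|N IH]; first by rewrite !big_ord0 !subrr.
by rewrite !big_ord_recr/=; move: IH; lra.
Qed.

Lemma approximate_poisson : exists Cv Ch Cl : R,
  [/\ 0 <= Cv, 0 <= Ch, 0 <= Cl & forall eps : R, 0 < eps ->
  exists u : V -> X -> R,
  [/\ forall theta x,
        `|f theta x - (u theta x - transition theta (u theta) x)| <= eps,
      forall theta x,
        `|u theta x| <= Cv /\ `|transition theta (u theta) x| <= Cv,
      forall theta theta' x,
        `|u theta x - u theta' x| <= Ch * Num.sqrt (enorm (theta - theta')) /\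
        `|transition theta (u theta) x - transition theta' (u theta') x| <=
           Ch * Num.sqrt (enorm (theta - theta')) &
      forall theta,
        lip Cl (u theta) /\ lip Cl (transition theta (u theta))]].
Proof.
have [D D0 HD] := iter_transition_decay.
have [H H0 HH] := iter_transition_hoelder.
have s0 := sqrtr_ge0 (1 - rho).
have s1 : Num.sqrt (1 - rho) < 1 by rewrite -[ltRHS]sqrtr1 ltr_sqrt.
have Cl0 : 0 <= A / rho by rewrite mulr_ge0// invr_ge0 ltW.
exists (A * D / rho), (H / (1 - Num.sqrt (1 - rho))), (A / rho); split => //.
- by apply: mulr_ge0; [exact: mulr_ge0|rewrite invr_ge0 ltW].
- by apply: mulr_ge0 => //; rewrite invr_ge0 subr_ge0 ltW.
move=> eps eps0.
have [N hN] : exists N, A * D * (1 - rho) ^+ N <= eps.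
  have : (fun n => A * D * (1 - rho) ^+ n) @ \oo --> A * D * 0.
    by apply: cvgMr; apply: cvg_expr; rewrite ger0_norm.
  rewrite mulr0 => /cvgrPdist_le/(_ _ eps0)[N _ /(_ N (leqnn N))] /=.
  rewrite sub0r normrN => h; exists N.
  by rewrite (le_trans (ler_norm _)).
(* Bounds the sum for u and, with the index shifted by one, the sum for P_theta u. It is used with
   ratio 1 - rho for size and with its square root for the Hoelder estimate. *)
have geo (q : R) (a : nat -> R) (B : R) : 0 <= q < 1 -> 0 <= B ->
    (forall j, `|a j| <= B * q ^+ j) ->
    `|\sum_(j < N) a j| <= B / (1 - q) /\ `|\sum_(j < N) a j.+1| <= B / (1 - q).
  move=> q01 B0 ha; have /andP[qp ql] := q01.
  have bnd (b : nat -> R) : (forall j, `|b j| <= B * q ^+ j) ->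
      `|\sum_(j < N) b j| <= B / (1 - q).
    move=> hb; apply: le_trans (ler_norm_sum _ _ _) _.
    apply: (@le_trans _ _ (\sum_(j < N) B * q ^+ j)).
      by apply: ler_sum => j _; exact: hb.
    by rewrite -mulr_sumr ler_wpM2l// sum_expr_le.
  split; first exact: bnd.
  apply: (bnd (fun j => a j.+1)) => j; apply: le_trans (ha _) _.
  by rewrite ler_wpM2l// exprS ler_piMl ?exprn_ge0// ltW.
have rE : 1 - (1 - rho) = rho by ring.
exists (poisson_sum N); split.
- move=> theta x; rewrite poisson_sumB opprB addrC subrK.
  by rewrite (le_trans (HD _ _ _)).
- move=> theta x; rewrite transition_poisson_sum -{1 2}rE.
  apply: (geo (1 - rho) (fun j => iter_transition j theta x) (A * D)).
  + by rewrite q0 q1.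
  + exact: mulr_ge0.
  + by move=> j; exact: HD.
- move=> theta theta' x; rewrite !transition_poisson_sum /poisson_sum -!sumrB.
  rewrite mulrAC.
  apply: (geo (Num.sqrt (1 - rho))
    (fun j => iter_transition j theta x - iter_transition j theta' x)).
  + by rewrite s0 s1.
  + by rewrite mulr_ge0 ?sqrtr_ge0.
  + by move=> j; exact: HH.
- move=> theta; split; first exact: poisson_sum_lip.
  move=> x y; apply: le_trans (transition_lip theta _ _ Cl0 (poisson_sum_lip N theta) x y) _.
  by rewrite ler_wpM2r ?mdist_ge0// ler_piMr// ltW.
Qed.

End poisson.

(** * Integration over a sub-sigma-algebra *)

Section sub_sigma_algebra.
Context {R : realType} {dO : measure_display} {Omega : measurableType dO}.
Variables (mu : {measure set Omega -> \bar R}) (G : set (set Omega)).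
Local Notation OG := (g_sigma_algebraType G).
Hypothesis subG : forall B : set Omega, <<s G>> B -> measurable B.

Lemma sub_measurable_fun d' (T : measurableType d') (f : Omega -> T) :
  measurable_fun [set: OG] (f : OG -> T) -> measurable_fun [set: Omega] f.
Proof. by move=> mf _ A mA; apply: subG; exact: (mf measurableT A mA). Qed.

Import HBNNSimple.

(** From indicators of sets of [G] to nonnegative [G]-measurable weights, by simple approximation
    and monotone convergence. The integrals stay in the extended reals, where either may be
    infinite. *)
Lemma weighted_integral_le (Y1 Y2 : Omega -> R) (f : Omega -> R) :
  measurable_fun [set: Omega] Y1 -> measurable_fun [set: Omega] Y2 ->
  (forall w, 0 <= Y1 w) -> (forall w, 0 <= Y2 w) ->
  (forall B, <<s G>> B ->
     (\int[mu]_(w in B) (Y1 w)%:E <= \int[mu]_(w in B) (Y2 w)%:E)%E) ->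
  measurable_fun [set: OG] (f : OG -> R) -> (forall w, 0 <= f w) ->
  (\int[mu]_w (f w * Y1 w)%:E <= \int[mu]_w (f w * Y2 w)%:E)%E.
Proof.
move=> mY1 mY2 Y10 Y20 Y12 mf f0.
have mEf : measurable_fun [set: OG] (EFin \o (f : OG -> R)).
  exact/measurable_EFinP.
have f0E w : [set: OG] w -> (0 <= (EFin \o (f : OG -> R)) w)%E.
  by move=> _; rewrite lee_fin.
pose h : {nnsfun OG >-> R}^nat := nnsfun_approx measurableT mEf.
have mh n : measurable_fun [set: Omega] (fun w : Omega => h n w).
  by apply: sub_measurable_fun; exact: measurable_funP.
have h0 n w : 0 <= h n w by exact: fun_ge0.
have hnd a b w : (a <= b)%N -> h a w <= h b w.
  by move=> ab; have /lefP := nd_nnsfun_approx measurableT mEf ab; apply.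
have hlim (Y : Omega -> R) : measurable_fun setT Y -> (forall w, 0 <= Y w) ->
    (\int[mu]_w (f w * Y w)%:E =
     limn (fun n => \int[mu]_w (h n w * Y w)%:E))%E.
  move=> mY Y0; rewrite -monotone_convergence//.
  - apply: eq_integral => w _; apply/esym/cvg_lim => //.
    have hf : (fun n => (h n w)%:E) @ \oo --> (f w)%:E.
      exact: (cvg_nnsfun_approx measurableT mEf f0E).
    have {}hf : (fun n => h n w) @ \oo --> f w by exact: fine_cvg hf.
    by apply: cvg_EFin; [exact: nearW|apply: cvgMl].
  - by move=> n; apply/measurable_EFinP/measurable_funM.
  - by move=> n w _; rewrite lee_fin mulr_ge0.
  - by move=> w _ a b ab; rewrite lee_fin ler_wpM2r// hnd.
have cv (Y : Omega -> R) : measurable_fun setT Y -> (forall w, 0 <= Y w) ->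
    cvgn (fun n => \int[mu]_w (h n w * Y w)%:E)%E.
  move=> mY Y0; apply: ereal_nondecreasing_is_cvgn => a b ab.
  apply: ge0_le_integral => //.
  - by move=> w _; rewrite lee_fin mulr_ge0.
  - exact/measurable_EFinP/measurable_funM.
  - exact/measurable_EFinP/measurable_funM.
  - by move=> w _; rewrite lee_fin ler_wpM2r// hnd.
rewrite !hlim//; apply: lee_lim; [exact: cv|exact: cv|].
apply: nearW => n.
have simple (Y : Omega -> R) : measurable_fun setT Y -> (forall w, 0 <= Y w) ->
    (\int[mu]_w (h n w * Y w)%:E = \sum_(r \in range (h n))
      r%:E * \int[mu]_(w in h n @^-1` [set r]) (Y w)%:E)%E.
  move=> mY Y0.
  have mI r : measurable_fun [set: Omega] (\1_(h n @^-1` [set r]) : Omega -> R).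
    apply: measurable_indic; apply: subG.
    exact: (measurable_sfunP (h n) (measurable_set1 r)).
  transitivity (\int[mu]_w (\sum_(r \in range (h n))
      (r * \1_(h n @^-1` [set r]) w * Y w)%:E)%E)%E.
    apply: eq_integral => w _; rewrite [in LHS]fimfunE/= mulr_fsuml//.
    by rewrite fsumEFin.
  rewrite ge0_integral_fsum//; last 2 first.
  - move=> r; apply/measurable_EFinP/measurable_funM => //.
    by apply: measurable_funM => //; exact: measurable_cst.
  - move=> r w _; rewrite lee_fin mulr_ge0// indicE.
    case: (boolP (w \in _)); rewrite ?mulr0// inE mulr1 => <-.
    exact: h0.
  apply: eq_fsbigr => r /[!inE] -[w0 _ hr].
  have r0 : 0 <= r by rewrite -hr.
  rewrite [in RHS]integral_mkcond -ge0_integralZl//.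
  - apply: eq_integral => w _; rewrite -mulrA EFinM; congr (_ * _)%E.
    by rewrite /patch indicE; case: (_ \in _); rewrite ?mul1r ?mul0r.
  - apply/(measurable_restrictT _ _).1.
      by apply: subG; exact: (measurable_sfunP (h n) (measurable_set1 r)).
    exact/measurable_EFinP/measurable_funTS.
  - by move=> w _; rewrite /patch; case: ifP; rewrite ?lee_fin.
rewrite !simple//; apply: lee_fsum => // r [w0 _ <-].
rewrite lee_wpmul2l ?lee_fin//; apply: Y12.
exact: (measurable_sfunP (h n) (measurable_set1 _)).
Qed.

(** Taking out what is known, with a possibly unbounded weight. The positive and negative parts of
    [Z] have equal integrals over every set of [G], hence against both parts of [W]; integrability
    of [W * Z] makes the four products finite. *)
Lemma weighted_integral_eq0 (Z W : Omega -> R) :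
  mu.-integrable setT (EFin \o Z) ->
  (forall B, <<s G>> B -> \int[mu]_(w in B) Z w = 0) ->
  measurable_fun [set: OG] (W : OG -> R) ->
  mu.-integrable setT (EFin \o (fun w => W w * Z w)) ->
  \int[mu]_w (W w * Z w) = 0.
Proof.
move=> iZ Z0 mW iWZ.
have mZ : measurable_fun setT Z by exact/measurable_EFinP/(measurable_int mu).
have mW' := sub_measurable_fun _ _ _ mW.
pose pos (f : Omega -> R) w := Num.max (f w) 0.
pose neg (f : Omega -> R) w := Num.max (- f w) 0.
have pos0 f w : 0 <= pos f w by rewrite le_max lexx orbT.
have neg0 f w : 0 <= neg f w by rewrite le_max lexx orbT.
have posneg f w : f w = pos f w - neg f w.
  rewrite /pos /neg; have [h|h] := leP (f w) 0.
    by rewrite max_l ?oppr_ge0// opprK add0r.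
  by rewrite max_r ?oppr_le0 ?(ltW h)// subr0.
have absE f w : `|f w| = pos f w + neg f w.
  rewrite /pos /neg; have [h|h] := leP (f w) 0.
    by rewrite max_l ?oppr_ge0// add0r ler0_norm.
  by rewrite max_r ?oppr_le0 ?(ltW h)// addr0 gtr0_norm.
have mpos f : measurable_fun setT f -> measurable_fun setT (pos f).
  by move=> mf; apply: measurable_maxr => //; exact: measurable_cst.
have mneg f : measurable_fun setT f -> measurable_fun setT (neg f).
  move=> mf; apply: measurable_maxr; last exact: measurable_cst.
  exact: measurableT_comp.
have iZpm B : measurable B -> \int[mu]_(w in B) Z w = 0 ->
    (\int[mu]_(w in B) (pos Z w)%:E = \int[mu]_(w in B) (neg Z w)%:E)%E.
  move=> mB.
  have iZB : mu.-integrable B (EFin \o Z) by exact: integrableS iZ.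
  have ip : mu.-integrable B (EFin \o pos Z).
    apply: le_integrable iZB => //; first exact/measurable_EFinP/measurable_funTS/mpos.
    by move=> w _; rewrite lee_fin (ger0_norm (pos0 _ _)) absE lerDl.
  have iN : mu.-integrable B (EFin \o neg Z).
    apply: le_integrable iZB => //; first exact/measurable_EFinP/measurable_funTS/mneg.
    by move=> w _; rewrite lee_fin (ger0_norm (neg0 _ _)) absE lerDr.
  rewrite (_ : \int[mu]_(w in B) Z w = \int[mu]_(w in B) (pos Z w - neg Z w)).
    rewrite RintegralB// => /subr0_eq h.
    rewrite -[LHS]fineK ?integrable_fin_num// -[RHS]fineK ?integrable_fin_num//.
    by congr EFin.
  by apply: eq_Rintegral => w _; exact: posneg.
have eqZ f : measurable_fun [set: OG] (f : OG -> R) -> (forall w, 0 <= f w) ->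
    (\int[mu]_w (f w * pos Z w)%:E = \int[mu]_w (f w * neg Z w)%:E)%E.
  move=> mf f0; apply/eqP; rewrite eq_le; apply/andP; split;
    apply: weighted_integral_le => //; try exact: mpos; try exact: mneg.
  - by move=> B GB; rewrite iZpm//; [exact: subG|exact: Z0].
  - by move=> B GB; rewrite iZpm//; [exact: subG|exact: Z0].
have iprod (f h : Omega -> R) : measurable_fun setT f -> measurable_fun setT h ->
    (forall w, 0 <= f w <= `|W w|) -> (forall w, 0 <= h w <= `|Z w|) ->
    mu.-integrable setT (EFin \o (fun w => f w * h w)).
  move=> mf mh fW hZ; apply: le_integrable iWZ => //.
    exact/measurable_EFinP/measurable_funM.
  move=> w _; have /andP[f0 f1] := fW w; have /andP[h0 h1] := hZ w.
  by rewrite lee_fin ger0_norm ?mulr_ge0// normrM ler_pM.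
have posb f w : 0 <= pos f w <= `|f w| by rewrite pos0/= absE lerDl.
have negb f w : 0 <= neg f w <= `|f w| by rewrite neg0/= absE lerDr.
have i1 := iprod _ _ (mpos _ mW') (mpos _ mZ) (posb W) (posb Z).
have i2 := iprod _ _ (mpos _ mW') (mneg _ mZ) (posb W) (negb Z).
have i3 := iprod _ _ (mneg _ mW') (mpos _ mZ) (negb W) (posb Z).
have i4 := iprod _ _ (mneg _ mW') (mneg _ mZ) (negb W) (negb Z).
have i12 : mu.-integrable setT (EFin \o (fun w => pos W w * pos Z w - pos W w * neg Z w)).
  by have := integrableB measurableT i1 i2; apply: eq_integrable.
have i34 : mu.-integrable setT (EFin \o (fun w => neg W w * pos Z w - neg W w * neg Z w)).
  by have := integrableB measurableT i3 i4; apply: eq_integrable.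
rewrite (_ : \int[mu]_w (W w * Z w) =
  \int[mu]_w ((pos W w * pos Z w - pos W w * neg Z w) -
    (neg W w * pos Z w - neg W w * neg Z w))); last first.
  by apply: eq_Rintegral => w _; rewrite (posneg W w) (posneg Z w); ring.
have mposG : measurable_fun [set: OG] (pos W : OG -> R).
  by apply: measurable_maxr => //; exact: measurable_cst.
have mnegG : measurable_fun [set: OG] (neg W : OG -> R).
  apply: measurable_maxr; last exact: measurable_cst.
  exact: measurableT_comp.
rewrite RintegralB// RintegralB// RintegralB// /Rintegral !eqZ//.
by rewrite !subrr.
Qed.

End sub_sigma_algebra.

(** * Measurability along the process *)

Section continuity.
Context {R : realType} {d : nat}.
Local Notation V := 'rV[R]_d.

Lemma coord_sub_continuous (s : V) i : continuous (fun t : V => (t - s) 0 i).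
Proof.
move=> z; rewrite /continuous_at !mxE; under eq_cvg do rewrite !mxE.
by apply: (@cvgB _ R^o _ (nbhs z) _ (fun t : V => t 0 i) (cst (s 0 i)));
  [exact: coord_continuous|exact: cvg_cst].
Qed.

Lemma enorm_sub_continuous (s : V) : continuous (fun t : V => enorm (t - s)).
Proof.
move=> t; apply: (@continuous_comp _ _ _ (fun t : V => edot (t - s) (t - s)) Num.sqrt);
  last exact: sqrt_continuous.
apply: (@continuous_big R^o _ +%R 0 xpredT _ V _
  (fun i (t : V) => (t - s) 0 i * (t - s) 0 i)); first exact: add_continuous.
move=> i _ z; have hc := @coord_sub_continuous s i z.
exact: (cvgM hc hc).
Qed.

Lemma hoelder_continuous (C : R) (f : V -> R) :
  (forall t t', `|f t - f t'| <= C * Num.sqrt (enorm (t - t'))) -> continuous f.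
Proof.
move=> fC t.
have h : (fun t' : V => C * Num.sqrt (enorm (t' - t))) @ t --> (0 : R).
  rewrite (_ : 0 = C * Num.sqrt (enorm (t - t))); last first.
    by rewrite subrr enorm0 sqrtr0 mulr0.
  have h1 : (fun t' : V => enorm (t' - t)) @ t --> enorm (t - t).
    exact: enorm_sub_continuous.
  have h2 := cvg_comp _ _ h1 (@sqrt_continuous R _).
  exact: (cvgM (cvg_cst C) h2).
apply/(@cvgrPdist_le _ _ _ (nbhs t) (nbhs_filter t)) => e e0.
move/(@cvgrPdist_le _ _ _ (nbhs t) (nbhs_filter t)) : h => /(_ _ e0).
apply: filterS => t'.
rewrite sub0r normrN => h.
by rewrite (le_trans (fC _ _))// enormB (le_trans (ler_norm _)).
Qed.

Lemma inv_expr_enorm_continuous (n : nat) (s : V) :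
  continuous (fun t : V => ((1 + enorm (t - s)) ^+ n)^-1).
Proof.
move=> t; apply: (@continuous_comp _ _ _ (fun t : V => enorm (t - s))
  (fun e : R => ((1 + e) ^+ n)^-1)); first exact: enorm_sub_continuous.
apply: cvgV.
  by rewrite expf_neq0// gt_eqF// ltr_wpDr// enorm_ge0.
apply: (@continuous_comp _ _ _ (fun e : R => 1 + e) (fun e : R => e ^+ n)).
  by apply: cvgD; [exact: cvg_cst|exact: cvg_id].
exact: exprn_continuous.
Qed.

End continuity.

Section evaluation.
Context {R : realType} {d : nat} {X : pointedMetricType R}.
Local Notation V := 'rV[R]_d.
Hypothesis cX : compact [set: X].
Context {dO : measure_display} {T : measurableType dO}.

Lemma Rintegral_dirac (L : R) (h : X -> R) (x : X) : lip L h ->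
  \int[\d_(x : borel X)]_y (h y : R) = h x.
Proof.
move=> Lh; have mh := lip_measurable _ _ Lh.
rewrite /Rintegral integral_dirac//; last exact/measurable_EFinP.
by rewrite diracT mul1e.
Qed.

Lemma dirac_measurable (x : T -> X) (A : set (borel X)) : measurable A ->
  measurable_fun [set: T] (x : T -> borel X) ->
  measurable_fun [set: T] (fun w => fine (\d_(x w : borel X) A) : R).
Proof.
move=> mA mx; rewrite (_ : (fun _ => _) = (\1_A : borel X -> R) \o x).
  by apply: measurableT_comp => //; exact: measurable_indic.
by apply/funext => w.
Qed.

(** Evaluation at x(w) is integration against the Dirac mass there, so joint measurability follows
    from [Rintegral_random_measurable]. *)
Lemma evaluation_measurable (theta : T -> V) (x : T -> X) (h : V -> X -> R) (C L : R) :
  measurable_fun [set: T] (theta : T -> borel V) ->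
  measurable_fun [set: T] (x : T -> borel X) ->
  0 <= L -> (forall t, lip L (h t)) ->
  (forall t t' y, `|h t y - h t' y| <= C * Num.sqrt (enorm (t - t'))) ->
  measurable_fun [set: T] (fun w => h (theta w) (x w)).
Proof.
move=> mt mx L0 hL hC.
have mh y : measurable_fun [set: T] (fun w => h (theta w) y).
  apply: (@measurableT_comp _ _ _ _ _ _ (fun t : borel V => h t y)) => //.
  by apply: continuous_borel_measurable; apply: hoelder_continuous => t t'; exact: hC.
have := @Rintegral_random_measurable _ _ cX _ _ (fun w => h (theta w)) L
  (fun w => hL (theta w)) L0 mh (fun w => \d_(x w : borel X)).
have -> : (fun w : T => \int[\d_(x w : borel X)]_y (h (theta w) y : R)) =
    fun w => h (theta w) (x w).
  by apply/funext => w; exact: Rintegral_dirac.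
apply=> [w|A mA]; first exact: diracT.
exact: dirac_measurable.
Qed.

Lemma enorm_sub_measurable (theta : T -> V) (s : V) :
  measurable_fun [set: T] (theta : T -> borel V) ->
  measurable_fun [set: T] (fun w => enorm (theta w - s)).
Proof.
move=> mt; apply: (@measurableT_comp _ _ _ _ _ _ (fun t : borel V => enorm ((t : V) - s))).
  by apply: continuous_borel_measurable; exact: enorm_sub_continuous.
exact: mt.
Qed.

Lemma coord_sub_measurable (theta : T -> V) (s : V) i :
  measurable_fun [set: T] (theta : T -> borel V) ->
  measurable_fun [set: T] (fun w => (theta w - s) 0 i).
Proof.
move=> mt; apply: (@measurableT_comp _ _ _ _ _ _ (fun t : borel V => ((t : V) - s) 0 i)).
  by apply: continuous_borel_measurable => t; exact: coord_sub_continuous.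
exact: mt.
Qed.

End evaluation.

Section history.
Context {R : realType} {d : nat} {X : pointedMetricType R}.
Local Notation V := 'rV[R]_d.
Context {dO : measure_display} {Omega : measurableType dO}.
Variables (theta : nat -> Omega -> V) (x : nat -> Omega -> X)
  (xi : nat -> Omega -> V -> V).
Local Notation history := (history theta x xi).

(** [g_sigma_algebraType] generates once more from [history], whereas [is_cond_exp] quantifies over
    the sets of [history] itself. *)
Lemma history_idem k : <<s history k>> = history k.
Proof. by apply: sigma_algebra_id; exact: smallest_sigma_algebra. Qed.

Lemma history_sub k :
  (forall k, measurable_fun [set: Omega] (theta k : Omega -> borel V)) ->
  (forall k, measurable_fun [set: Omega] (x k : Omega -> borel X)) ->
  (forall k t, measurable_fun [set: Omega] ((fun w => xi k.+1 w t) : Omega -> borel V)) ->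
  forall B, <<s history k>> B -> measurable B.
Proof.
move=> mt mx mxi B; rewrite history_idem.
have sm : sigma_algebra setT (@measurable _ Omega).
  split; first exact: measurable0.
  - by move=> A mA; rewrite setTD; exact: measurableC.
  - by move=> F mF; exact: bigcup_measurable.
suff : history k `<=` @measurable _ Omega by apply.
rewrite /Defs.history; apply: smallest_sub; first exact: sm.
move=> {}B [[t /= tk [[A mA <-]|[A mA <-]]]|].
- exact: mt.
- exact: mx.
move=> [[//|t] /= tk [A mA <-]]; rewrite setTI.
move: A mA; rewrite /field_measurable.
apply: (@smallest_sub _ _ _ [set A | measurable (xi t.+1 @^-1` A)]).
  split => /=; first by rewrite preimage_set0.
  - by move=> A mA; rewrite setTD preimage_setC; exact: measurableC.
  - by move=> F mF; rewrite preimage_bigcup; exact: bigcup_measurable.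
move=> A [s _ [C mC <-]] /=; rewrite setTI.
by have := mxi t s measurableT C mC; rewrite setTI.
Qed.

Lemma history_theta k :
  measurable_fun [set: g_sigma_algebraType (history k)]
    (theta k : g_sigma_algebraType (history k) -> borel V).
Proof.
move=> _ A mA; apply: sub_sigma_algebra; apply: sub_sigma_algebra.
by left; exists k => //=; left; exists A.
Qed.

End history.

(** * Conditional laws *)

Section one_step.
Context {R : realType} {d : nat} {X : pointedMetricType R}.
Local Notation V := 'rV[R]_d.
Context {dO : measure_display} {Omega : measurableType dO}.
Variables (P : probability Omega R) (theta : nat -> Omega -> V)
  (x : nat -> Omega -> X) (xi : nat -> Omega -> V -> V)
  (K : V -> R.-pker (borel X) ~> (borel X)) (g : V -> X -> V) (alpha : R).
Hypothesis cX : compact [set: X].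
Hypothesis sa : sa_iterates P theta x xi K g alpha.
Local Notation G k := (history theta x xi k).

Let P1 : P setT = 1%E. Proof. exact: probability_setT. Qed.
Let K1 t y : (K t y setT = 1)%E. Proof. exact: prob_kernel. Qed.

Let subG k B : <<s G k>> B -> measurable B.
Proof.
exact: (history_sub _ _ _ k (sa_theta_meas sa) (sa_x_meas sa) (sa_xi_meas sa)).
Qed.

Let K01 t y (A : set (borel X)) : measurable A ->
  0 <= fine (K t y A) <= 1 /\ K t y A \is a fin_num.
Proof.
move=> mA; have h1 : (K t y A <= 1)%E.
  by rewrite -(K1 t y); apply: le_measure; rewrite ?inE.
have hf : K t y A \is a fin_num by rewrite ge0_fin_numE// (le_lt_trans h1)// ltry.
by rewrite fine_ge0//= -lee_fin fineK.
Qed.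

Let mKG k (A : set (borel X)) : measurable A ->
  measurable_fun [set: g_sigma_algebraType (G k)]
    ((fun w => fine (K (theta k w) (x k w) A)) : g_sigma_algebraType (G k) -> R).
Proof.
move=> mA; have [_ _ mZ _] := sa_law sa k mA.
exact: measurableT_comp.
Qed.

(** The difference of the kernel mass of A and the indicator of X_{k+1} in A integrates to 0 over
    every history set, so [weighted_integral_eq0] applies. *)
Lemma conditional_law_weighted k (A : set (borel X)) (W : Omega -> R) (M : R) :
  measurable A ->
  measurable_fun [set: g_sigma_algebraType (G k)] (W : g_sigma_algebraType (G k) -> R) ->
  (forall w, `|W w| <= M) ->
  \int[P]_w (W w * fine (K (theta k w) (x k w) A)) =
  \int[P]_w (W w * \1_A (x k.+1 w : borel X)).
Proof.
move=> mA mW WM.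
have M0 : 0 <= M := le_trans (normr_ge0 _) (WM point).
have mW' := sub_measurable_fun _ (@subG k) _ _ _ mW.
have mQ := sub_measurable_fun _ (@subG k) _ _ _ (@mKG k A mA).
have mI : measurable_fun [set: Omega] (fun w => \1_A (x k.+1 w : borel X) : R).
  apply: (@measurableT_comp _ _ _ _ _ _ (\1_A : borel X -> R)).
    exact: measurable_indic.
  exact: sa_x_meas sa _.
have Ib w : 0 <= (\1_A (x k.+1 w : borel X) : R) <= 1.
  by rewrite indicE; case: (_ \in _); rewrite /= ?lexx ?ler01.
have iQ : P.-integrable setT (EFin \o (fun w => fine (K (theta k w) (x k w) A))).
  apply: (@bounded_le_integrable _ _ _ P P1 _ 1) => // w.
  by have [/andP[? ?] _] := K01 (theta k w) (x k w) A mA; rewrite ger0_norm.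
have iI : P.-integrable setT (EFin \o (fun w => \1_A (x k.+1 w : borel X) : R)).
  apply: (@bounded_le_integrable _ _ _ P P1 _ 1) => // w.
  by have /andP[? ?] := Ib w; rewrite ger0_norm.
have iWQ : P.-integrable setT (EFin \o (fun w => W w * fine (K (theta k w) (x k w) A))).
  apply: (@bounded_le_integrable _ _ _ P P1 _ M).
    exact: measurable_funM.
  move=> w; have [/andP[? ?] _] := K01 (theta k w) (x k w) A mA.
  by rewrite normrM (ger0_norm (x := fine _))// (le_trans _ (WM w))// ler_piMr.
have iWI : P.-integrable setT (EFin \o (fun w => W w * \1_A (x k.+1 w : borel X))).
  apply: (@bounded_le_integrable _ _ _ P P1 _ M).
    exact: measurable_funM.
  move=> w; have /andP[h0 h1] := Ib w.
  by rewrite normrM (ger0_norm h0) (le_trans _ (WM w))// ler_piMr.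
have iD : P.-integrable setT (EFin \o
    (fun w => fine (K (theta k w) (x k w) A) - \1_A (x k.+1 w : borel X))).
  by have := integrableB measurableT iQ iI; apply: eq_integrable.
apply/eqP; rewrite -subr_eq0 -RintegralB//; apply/eqP.
rewrite -[RHS](@weighted_integral_eq0 _ _ _ P _ (@subG k) (fun w =>
  fine (K (theta k w) (x k w) A) - \1_A (x k.+1 w : borel X)) W iD _ mW).
- by apply: eq_Rintegral => w _; rewrite mulrBr.
- move=> B GB; have mB := subG _ _ GB.
  rewrite RintegralB//; [|exact: integrableS iQ|exact: integrableS iI].
  have [_ _ _ hZ] := sa_law sa k mA.
  have := hZ B; rewrite -(history_idem theta x xi k) => /(_ GB) h.
  rewrite /Rintegral; apply/eqP; rewrite subr_eq0; apply/eqP; congr fine.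
  rewrite (eq_integral (fun w => K (theta k w) (x k w) A)); last first.
    by move=> w _; rewrite fineK//; case: (K01 (theta k w) (x k w) A mA).
  by rewrite h; apply: eq_integral => w _; rewrite !indicE.
- have := integrableB measurableT iWQ iWI; apply: eq_integrable => //.
  by move=> w _ /=; rewrite mulrBr EFinB.
Qed.

(** The martingale property of the Poisson increment. For fixed y the weight 1_B h(theta_k, y) is
    measurable for the history, so [Rintegral_random_eq] can compare the kernel at (theta_k, X_k)
    with the Dirac mass at X_{k+1}. *)
Lemma conditional_transition k (h : V -> X -> R) (C L M : R) :
  0 <= L -> (forall t, lip L (h t)) ->
  (forall t t' y, `|h t y - h t' y| <= C * Num.sqrt (enorm (t - t'))) ->
  (forall t y, `|h t y| <= M) ->
  measurable_fun setT (fun w => transition K (theta k w) (h (theta k w)) (x k w)) ->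
  (forall w, `|transition K (theta k w) (h (theta k w)) (x k w)| <= M) ->
  forall B, <<s G k>> B ->
  \int[P]_(w in B) (h (theta k w) (x k.+1 w) -
    transition K (theta k w) (h (theta k w)) (x k w)) = 0.
Proof.
move=> L0 hL hC hM mT TM B GB; have mB := subG _ _ GB.
have M0 : 0 <= M := le_trans (normr_ge0 _) (hM point point).
have mth := sa_theta_meas sa k; have mx' := sa_x_meas sa k.+1.
have ih : P.-integrable setT (EFin \o (fun w => h (theta k w) (x k.+1 w))).
  apply: (@bounded_le_integrable _ _ _ P P1 _ M) => //.
  exact: (evaluation_measurable cX _ _ _ _ _ mth mx' L0 hL hC).
have iT := @bounded_le_integrable _ _ _ P P1 _ M mT TM.
rewrite RintegralB//; [|exact: integrableS ih|exact: integrableS iT].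
pose F (w : Omega) y : R := \1_B w * h (theta k w) y.
have B01 w : 0 <= (\1_B w : R) <= 1 by rewrite indicE; case: (_ \in _); rewrite /= ?lexx ?ler01.
have FL w : lip L (F w).
  move=> y y'; rewrite /F -mulrBr normrM; have /andP[b0 b1] := B01 w.
  by rewrite (ger0_norm b0) (le_trans _ (hL (theta k w) y y'))// ler_piMl.
have FM w y : `|F w y| <= M.
  rewrite /F normrM; have /andP[b0 b1] := B01 w.
  by rewrite (ger0_norm b0) (le_trans _ (hM (theta k w) y))// ler_piMl.
have mFG y : measurable_fun [set: g_sigma_algebraType (G k)]
    ((F^~ y) : g_sigma_algebraType (G k) -> R).
  apply: measurable_funM; first exact: measurable_indic.
  apply: (@measurableT_comp _ _ _ _ _ _ (fun t : borel V => h t y)) => //.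
    by apply: continuous_borel_measurable; apply: hoelder_continuous => t t'; exact: hC.
  exact: history_theta.
have mF y := sub_measurable_fun _ (@subG k) _ _ _ (mFG y).
pose S (w : Omega) : {measure set (borel X) -> \bar R} := \d_(x k.+1 w : borel X).
have := @Rintegral_random_eq _ _ cX _ _ P P1 F L M FL L0 mF
  (fun w => K (theta k w) (x k w)) S FM (fun w => K1 _ _) (fun w => diracT _ _)
  (fun A mA => sub_measurable_fun _ (@subG k) _ _ _ (@mKG k A mA))
  (fun A mA => dirac_measurable _ _ mA mx').
have -> : (fun w => \int[S w]_y (F w y : R)) = (fun w => h (theta k w) (x k.+1 w)) \_ B.
  apply/funext => w; rewrite (Rintegral_dirac _ _ _ (FL w)) /F /patch indicE.
  by case: (_ \in _); rewrite ?mul1r ?mul0r.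
have -> : (fun w => \int[K (theta k w) (x k w)]_y (F w y : R)) =
    (fun w => transition K (theta k w) (h (theta k w)) (x k w)) \_ B.
  apply/funext => w; rewrite /F RintegralZl//; last first.
    exact: lip_integrable cX _ _ _ (K1 _ _) (hL (theta k w)).
  rewrite /patch indicE -/(transition K (theta k w) (h (theta k w)) (x k w)).
  by case: (_ \in _); rewrite ?mul1r ?mul0r.
rewrite -!Rintegral_mkcond => ->; first by rewrite subrr.
move=> A y mA; rewrite (@conditional_law_weighted k A (F^~ y) M mA (mFG y))//.
Qed.

(** The weight f / (1 + r)^(2p) is measurable for the history; the constant 2 comes from 1 + r^(2p)
    <= 2 (1 + r)^(2p). *)
Lemma noise_weighted p thetas L2p Lxi k (f : Omega -> R) :
  noise P theta x xi p thetas L2p Lxi ->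
  measurable_fun [set: g_sigma_algebraType (G k)] (f : g_sigma_algebraType (G k) -> R) ->
  (forall w, 0 <= f w) ->
  (\int[P]_w (f w * (enorm (xi k.+1 w (theta k w)) /
     (1 + enorm (theta k w - thetas))) ^+ (2 * p))%:E <=
   \int[P]_w (f w * (2 * L2p))%:E)%E.
Proof.
move=> ns mf f0.
have L0 : 0 <= L2p by rewrite ltW// (noise_L2p_gt0 ns).
pose z w := enorm (xi k.+1 w (theta k w)).
pose r w := enorm (theta k w - thetas).
have mrG : measurable_fun [set: g_sigma_algebraType (G k)]
    (r : g_sigma_algebraType (G k) -> R).
  by apply: enorm_sub_measurable; exact: history_theta.
have mr := sub_measurable_fun _ (@subG k) _ _ _ mrG.
have r0 w : 0 <= r w by exact: enorm_ge0.
have b0 w : 0 < 1 + r w by rewrite ltr_wpDr.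
have z0 w : 0 <= z w by exact: enorm_ge0.
have [Z [[mY _ mZG hZ] ZU]] := noise_moment ns k.
have mZ := sub_measurable_fun _ (@subG k) _ _ _ mZG.
pose U w := L2p * (1 + r w ^+ (2 * p)).
have mU : measurable_fun setT U.
  apply: measurable_funM; first exact: measurable_cst.
  by apply: measurable_funD; [exact: measurable_cst|exact: measurable_funX].
have U0 w : 0 <= U w by rewrite mulr_ge0// addr_ge0// exprn_ge0.
have mz : measurable_fun setT (fun w => z w ^+ (2 * p)) by exact/measurable_EFinP.
have cmp B : <<s G k>> B ->
    (\int[P]_(w in B) (z w ^+ (2 * p))%:E <= \int[P]_(w in B) (U w)%:E)%E.
  move=> GB; have mB := subG _ _ GB.
  have := hZ B; rewrite -(history_idem theta x xi k) => /(_ GB) <-.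
  (* The version [Z] of the conditional expectation has no prescribed sign, so its positive part is
     compared with [U]. *)
  rewrite integralE; apply: (@le_trans _ _ (\int[P]_(w in B) (Z^\+ w))%E).
    by rewrite -[leRHS]sube0 leeB// integral_ge0.
  apply: ae_ge0_le_integral => //.
  - exact/measurable_funepos/measurable_funTS.
  - by move=> w _; rewrite lee_fin.
  - exact/measurable_EFinP/measurable_funTS.
  - apply: filterS ZU => w h _; rewrite funeposE ge_max h/= lee_fin.
    exact: U0.
pose f' w := f w * ((1 + r w) ^+ (2 * p))^-1.
have p0 w : 0 < (1 + r w) ^+ (2 * p) by exact: exprn_gt0.
have f'0 w : 0 <= f' w by rewrite mulr_ge0// invr_ge0 ltW.
have mf' : measurable_fun [set: g_sigma_algebraType (G k)]
    (f' : g_sigma_algebraType (G k) -> R).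
  apply: measurable_funM => //.
  apply: (@measurableT_comp _ _ _ _ _ _
    (fun t : borel V => ((1 + enorm ((t : V) - thetas)) ^+ (2 * p))^-1)).
    by apply: continuous_borel_measurable; exact: inv_expr_enorm_continuous.
  exact: history_theta.
have mfO := sub_measurable_fun _ (@subG k) _ _ _ mf.
have mfO' := sub_measurable_fun _ (@subG k) _ _ _ mf'.
have := @weighted_integral_le _ _ _ P _ (@subG k) _ _ f' mz mU
  (fun w => exprn_ge0 _ (z0 w)) U0 cmp mf' f'0.
have -> : (\int[P]_w (f' w * z w ^+ (2 * p))%:E =
    \int[P]_w (f w * (z w / (1 + r w)) ^+ (2 * p))%:E)%E.
  apply: eq_integral => w _; congr EFin.
  by rewrite /f' expr_div_n -mulrA; congr (_ * _); rewrite mulrC.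
move=> /le_trans; apply; apply: ge0_le_integral => //.
- by move=> w _; rewrite lee_fin mulr_ge0.
- exact/measurable_EFinP/measurable_funM.
- by apply/measurable_EFinP/measurable_funM => //; exact: measurable_cst.
- move=> w _; rewrite lee_fin /f' -mulrA ler_wpM2l// /U mulrCA.
  rewrite [leRHS]mulrC ler_wpM2l// mulrC ler_pdivrMr//.
  have h1 : 1 <= (1 + r w) ^+ (2 * p) by rewrite exprn_ege1// lerDl.
  have h2 : r w ^+ (2 * p) <= (1 + r w) ^+ (2 * p).
    by rewrite lerXn2r ?nnegrE ?(ltW (b0 w))// lerDr.
  by lra.
Qed.

End one_step.

(** * Drift in expectation *)

Lemma integrable_weighted {R : realType} {dO : measure_display}
    {Omega : measurableType dO} (P : {measure set Omega -> \bar R})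
    (N T : Omega -> R) (l : R) :
  P.-integrable setT (EFin \o N) -> measurable_fun setT T ->
  (forall w, 0 <= N w) -> (forall w, 0 <= T w) ->
  (\int[P]_w (N w * T w)%:E <= \int[P]_w (N w * l)%:E)%E ->
  P.-integrable setT (EFin \o (fun w => N w * T w)).
Proof.
move=> iN mT N0 T0 NT.
have mN : measurable_fun setT N by exact/measurable_EFinP/(measurable_int P).
apply/integrableP; split; first exact/measurable_EFinP/measurable_funM.
under eq_integral => w _ do rewrite /= ger0_norm ?mulr_ge0//.
apply: le_lt_trans NT _; apply: integrable_lty => //.
by have := integrableZr measurableT l iN; apply: eq_integrable.
Qed.

(** Integrates a pathwise drift inequality. Integrability of [S'] is a conclusion: comparability
    gives S' <= 2 V' + 2 C0, and the drift bounds V' by an integrable function. This lets the moment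
    bound propagate along the iterates. *)
Lemma drift_expectation {R : realType} {dO : measure_display}
    {Omega : measurableType dO} (P : probability Omega R) (n : nat)
    (S S' V V' T : Omega -> R) (D : 'I_n -> Omega -> R) (b c e l kappa C0 : R) :
  P.-integrable setT (EFin \o S) -> (forall w, 0 <= S w) -> (forall w, 0 <= S' w) ->
  measurable_fun setT S' -> measurable_fun setT V -> measurable_fun setT V' ->
  measurable_fun setT T -> (forall w, 0 <= T w) ->
  (forall w, `|V w - S w| <= S w / 2 + C0) ->
  (forall w, `|V' w - S' w| <= S' w / 2 + C0) ->
  (forall i, P.-integrable setT (EFin \o D i)) ->
  (forall i, \int[P]_w D i w = 0) ->
  0 <= e -> 0 <= c ->
  (\int[P]_w ((e * S w + c) * T w)%:E <= \int[P]_w ((e * S w + c) * l)%:E)%E ->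
  (forall w, V' w <= V w - b * S w + kappa * (\sum_i D i w) +
     (e * S w + c) * (1 + T w)) ->
  [/\ P.-integrable setT (EFin \o S'), P.-integrable setT (EFin \o V),
      P.-integrable setT (EFin \o V') &
    \int[P]_w V' w <= \int[P]_w V w - b * \int[P]_w S w +
      (1 + l) * (e * \int[P]_w S w + c)].
Proof.
move=> iS S0 S'0 mS' mV mV' mT T0 VS VS' iD D0 e0 c0 NT drift.
have P1 : P setT = 1%E by exact: probability_setT.
have icst r : P.-integrable setT (EFin \o cst r) by exact: integrable_probability_cst.
have add (u v : Omega -> R) : P.-integrable setT (EFin \o u) ->
    P.-integrable setT (EFin \o v) -> P.-integrable setT (EFin \o (fun w => u w + v w)).
  by move=> iu iv; have := integrableD measurableT iu iv; apply: eq_integrable.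
have scale r (u : Omega -> R) : P.-integrable setT (EFin \o u) ->
    P.-integrable setT (EFin \o (fun w => r * u w)).
  by move=> iu; have := integrableZl measurableT r iu; apply: eq_integrable.
have dom (u v : Omega -> R) : measurable_fun setT u -> P.-integrable setT (EFin \o v) ->
    (forall w, `|u w| <= v w) -> P.-integrable setT (EFin \o u).
  move=> mu iv uv; apply: le_integrable iv => //; first exact/measurable_EFinP.
  by move=> w _ /=; rewrite lee_fin (le_trans (uv w))// ler_norm.
have iV : P.-integrable setT (EFin \o V).
  apply: (dom _ (fun w => (3 / 2) * S w + cst C0 w)) => //.
    by apply: add => //; exact: scale.
  move=> w /=; have := VS w; rewrite !ler_norml => /andP[h1 h2].
  by have hS := S0 w; apply/andP; split; lra.
pose N w := e * S w + cst c w.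
have iN : P.-integrable setT (EFin \o N) by apply: add => //; exact: scale.
have N0 w : 0 <= N w by rewrite addr_ge0// mulr_ge0.
have iNl : P.-integrable setT (EFin \o (fun w => l * N w)) by exact: scale.
have iNT := integrable_weighted P N T l iN mT N0 T0 NT.
have sumD (s : seq 'I_n) : P.-integrable setT (EFin \o (fun w => \sum_(i <- s) D i w)) /\
    \int[P]_w (\sum_(i <- s) D i w) = 0.
  elim: s => [|i s [IH1 IH2]].
    rewrite (_ : (fun _ => _) = cst 0); last by apply/funext => w; rewrite big_nil.
    by split => //; rewrite Rintegral_probability_cst.
  rewrite (_ : (fun _ => _) = fun w => D i w + \sum_(j <- s) D j w); last first.
    by apply/funext => w; rewrite big_cons.
  by split; [exact: add|rewrite RintegralD// IH2 D0 addr0].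
have [iDs Ds0] := sumD (index_enum 'I_n).
pose Phi w := (V w + - b * S w) + (kappa * (\sum_i D i w) + (N w + N w * T w)).
have i1 := add _ _ iV (scale (- b) _ iS).
have i2 := add _ _ iN iNT.
have i3 := add _ _ (scale kappa _ iDs) i2.
have iPhi : P.-integrable setT (EFin \o Phi) by exact: add i1 i3.
have VPhi w : V' w <= Phi w.
  by apply: le_trans (drift w) _; rewrite /Phi /N /=; lra.
have iS' : P.-integrable setT (EFin \o S').
  apply: (dom _ (fun w => 2 * Phi w + cst (2 * C0) w)) => //.
    by apply: add => //; exact: scale.
  move=> w /=; rewrite ger0_norm//; have := VS' w; rewrite ler_norml => /andP[h1 h2].
  by have := VPhi w; lra.
have iV' : P.-integrable setT (EFin \o V').
  apply: (dom _ (fun w => (3 / 2) * S' w + cst C0 w)) => //.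
    by apply: add => //; exact: scale.
  move=> w /=; have := VS' w; rewrite !ler_norml => /andP[h1 h2].
  by have hS := S'0 w; apply/andP; split; lra.
split => //.
have NTl : \int[P]_w (N w * T w) <= l * \int[P]_w N w.
  rewrite -RintegralZl// -lee_fin !fineK ?integrable_fin_num//.
  by apply: le_trans NT _; rewrite le_eqVlt; apply/orP; left; apply/eqP;
    apply: eq_integral => w _; rewrite mulrC.
have intN : \int[P]_w N w = e * \int[P]_w S w + c.
  by rewrite RintegralD ?RintegralZl ?Rintegral_probability_cst//; exact: scale.
apply: (@le_trans _ _ (\int[P]_w Phi w)); first exact: le_Rintegral.
rewrite /Phi RintegralD// RintegralD//; last exact: scale.
rewrite RintegralZl// RintegralD//; last exact: scale.
rewrite RintegralZl// Ds0 mulr0 add0r RintegralD// -intN.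
by lra.
Qed.

Lemma affine_recursion {R : realFieldType} (q c : R) (a : nat -> R) : 0 <= q < 1 ->
  0 <= c -> (forall k, a k.+1 <= q * a k + c) ->
  forall k, a k <= q ^+ k * a 0%N + c / (1 - q).
Proof.
move=> /andP[q0 q1] c0 ha; have q1' : 0 < 1 - q by rewrite subr_gt0.
elim=> [|k IH]; first by rewrite expr0 mul1r lerDl divr_ge0// ltW.
apply: le_trans (ha k) _; apply: le_trans (lerD (ler_wpM2l q0 IH) (lexx c)) _.
rewrite le_eqVlt; apply/orP; left; apply/eqP; rewrite exprS; field.
by rewrite gt_eqF.
Qed.

(** * One-step drift of the Lyapunov function along the iterates *)

Section assembly.
Context {R : realType} {d : nat} {X : pointedMetricType R}.
Local Notation V := 'rV[R]_d.
Variables (K : V -> R.-pker (borel X) ~> (borel X))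
  (pi_ : V -> probability (borel X) R) (g : V -> X -> V) (thetas : V)
  (L1 mu rho LP L2p Lxi : R) (p : nat).
Local Notation gbar := (mean_field pi_ g).
Hypothesis inv : forall theta, unique_invariant (K theta) (pi_ theta).
Hypothesis root : gbar thetas = 0.
Hypothesis reg : regularity g gbar thetas L1.
Hypothesis mono : monotonicity gbar mu.
Hypothesis ker : kernel_contraction K rho LP.

Let cX : compact [set: X] := ker_compact ker.
Let L10 : 0 <= L1. Proof. by rewrite ltW// (reg_L1_gt0 reg). Qed.

(** Order 0 of [reg_lip], where the operator norm over the empty tuple is the Euclidean norm. *)
Lemma regularity_lip t t' y y' :
  enorm (g t y - g t' y') <= L1 * (enorm (t - t') + mdist y y').
Proof.
rewrite -lee_fin; apply: le_trans (reg_lip reg y y' t t' (leq0n 2)).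
by apply: ereal_sup_ubound; exists [tuple] => // -[].
Qed.

(** The scalar Poisson equation is solved for each coordinate of g - gbar; the constants are summed
    over coordinates. *)
Lemma vector_poisson : exists Cv Ch Cl : R,
  [/\ 0 <= Cv, 0 <= Ch, 0 <= Cl & forall eps : R, 0 < eps ->
  exists u : 'I_d -> V -> X -> R,
  let uV t y := \row_i u i t y in
  let vV t y := \row_i transition K t (u i t) y in
  [/\ forall t y, enorm (g t y - gbar t - (uV t y - vV t y)) <= eps,
      forall t y, enorm (vV t y) <= Cv,
      forall t t' y, enorm (vV t y - vV t' y) <= Ch * Num.sqrt (enorm (t - t')),
      forall i t y, `|u i t y| <= Cv /\ `|transition K t (u i t) y| <= Cv &
      forall i, [/\ forall t t' y,
          `|u i t y - u i t' y| <= Ch * Num.sqrt (enorm (t - t')),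
        forall t t' y, `|transition K t (u i t) y - transition K t' (u i t') y|
            <= Ch * Num.sqrt (enorm (t - t')),
        forall t, lip Cl (u i t) & forall t, lip Cl (transition K t (u i t))]]].
Proof.
pose f i t y := g t y 0 i - gbar t 0 i.
have A0 : 0 <= 2 * L1 by rewrite mulr_ge0.
have fL i t : lip (2 * L1) (f i t).
  move=> y y'; rewrite /f opprB addrA subrK.
  have h := ler_coord_enorm (g t y - g t y') i; rewrite !mxE in h.
  apply: le_trans h _; apply: le_trans (regularity_lip t t y y') _.
  rewrite subrr enorm0 add0r; have := mulr_ge0 L10 (mdist_ge0 y y'); lra.
have fT i t t' y : `|f i t y - f i t' y| <= 2 * L1 * enorm (t - t').
  have h1 := ler_coord_enorm (g t y - g t' y) i.
  have h2 := ler_coord_enorm (gbar t - gbar t') i.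
  have h3 := regularity_lip t t' y y; rewrite mdistxx addr0 in h3.
  have h4 := reg_gbar_lip reg t t'.
  rewrite [X in `|X|](_ : _ = (g t y - g t' y) 0 i - (gbar t - gbar t') 0 i).
    apply: le_trans (ler_normB _ _) _; lra.
  by rewrite /f !mxE; ring.
have fC i t : exists2 nu : probability (borel X) R,
    invariant_law (K t) nu & \int[nu]_y (f i t y : R) = 0.
  exists (pi_ t); first exact: (inv t).1.
  have pi1 : pi_ t setT = 1%E by exact: probability_setT.
  have Lg : lip L1 (fun y => g t y 0 i).
    move=> y y'; have h := ler_coord_enorm (g t y - g t y') i; rewrite !mxE in h.
    apply: le_trans h _; apply: le_trans (regularity_lip t t y y') _.
    by rewrite subrr enorm0 add0r.
  have ig := lip_integrable cX _ _ _ pi1 Lg.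
  rewrite /f RintegralB//; last exact: (integrable_probability_cst _ _ _ pi1).
  rewrite (Rintegral_probability_cst _ _ _ pi1 (gbar t 0 i)).
  by rewrite /mean_field mxE subrr.
have H i := approximate_poisson _ _ _ ker (f i) (2 * L1) A0 (fL i) (fT i) (fC i).
have [Cv HCv] := choice H; have [Ch HCh] := choice HCv.
have [Cl HCl] := choice HCh => {H HCv HCh}.
have Cv0 i : 0 <= Cv i by case: (HCl i).
have Ch0 i : 0 <= Ch i by case: (HCl i).
have Cl0 i : 0 <= Cl i by case: (HCl i).
have le_sum (F : 'I_d -> R) i : (forall j, 0 <= F j) -> F i <= \sum_j F j.
  by move=> F0; rewrite (bigD1 i)//= lerDl sumr_ge0.
exists (\sum_i Cv i), (\sum_i Ch i), (\sum_i Cl i); split; try exact: sumr_ge0.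
move=> eps eps0.
(* Accuracy per coordinate; [d.+1] also covers d = 0. *)
have eps0' : 0 < eps / d.+1%:R by rewrite divr_gt0.
have /choice[u Hu] : forall i, exists ui, _ := fun i =>
  let: And4 _ _ _ h := HCl i in h _ eps0'.
exists u => uV vV.
have hC i (t t' : V) : Ch i * Num.sqrt (enorm (t - t')) <=
    (\sum_i Ch i) * Num.sqrt (enorm (t - t')).
  by rewrite ler_wpM2r ?sqrtr_ge0// le_sum.
split.
- move=> t y; apply: le_trans (enorm_le_sum _) _.
  apply: (@le_trans _ _ (\sum_(i < d) eps / d.+1%:R)).
    apply: ler_sum => i _; have [h _ _ _] := Hu i; have := h t y.
    rewrite [X in _ -> `|X| <= _](_ : _ =
      f i t y - (u i t y - transition K t (u i t) y))//.
    by rewrite /f !mxE.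
  rewrite sumr_const card_ord -[leLHS]mulr_natr mulrAC ler_pdivrMr//.
  by rewrite ler_wpM2l ?(ltW eps0)// ler_nat.
- move=> t y; apply: le_trans (enorm_le_sum _) _.
  apply: ler_sum => i _; have [_ h _ _] := Hu i; have [_ h2] := h t y.
  by rewrite mxE.
- move=> t t' y; apply: le_trans (enorm_le_sum _) _.
  rewrite mulr_suml; apply: ler_sum => i _; have [_ _ h _] := Hu i.
  by have [_ h2] := h t t' y; rewrite !mxE.
- move=> i t y; have [_ h _ _] := Hu i; have [h1 h2] := h t y.
  by split; [apply: le_trans h1 _|apply: le_trans h2 _]; exact: le_sum.
- move=> i; have [_ _ h hl] := Hu i; split.
  + by move=> t t' y; have [h1 _] := h t t' y; exact: (le_trans h1 (hC i t t')).
  + by move=> t t' y; have [_ h1] := h t t' y; exact: (le_trans h1 (hC i t t')).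
  + move=> t y y'; have [h1 _] := hl t; apply: le_trans (h1 y y') _.
    by rewrite ler_wpM2r ?mdist_ge0// le_sum.
  + move=> t y y'; have [_ h1] := hl t; apply: le_trans (h1 y y') _.
    by rewrite ler_wpM2r ?mdist_ge0// le_sum.
Qed.


Let mu0 : 0 < mu. Proof. by case: mono. Qed.

(** [is_cond_exp] offers integrability or nonnegativity; in the second case the integral over the
    whole space is 0, hence finite. *)
Lemma noise_integrable {dO : measure_display} {Omega : measurableType dO}
    (P : probability Omega R) (theta : nat -> Omega -> V) (x : nat -> Omega -> X)
    (xi : nat -> Omega -> V -> V) k i :
  noise P theta x xi p thetas L2p Lxi ->
  P.-integrable setT (EFin \o (fun w => xi k.+1 w (theta k w) 0 i)).
Proof.
move=> ns; have [mY [Y0|//] _ hB] := noise_centered_iterate ns k i.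
have hT : history theta x xi k setT.
  rewrite -history_idem.
  exact: (@measurableT _ (g_sigma_algebraType (history theta x xi k))).
have {}Y0 w : 0 <= xi k.+1 w (theta k w) 0 i by rewrite -lee_fin.
apply/integrableP; split => //.
under eq_integral => w _ do rewrite /= ger0_norm//.
by rewrite -(hB _ hT) integral_cst// mul0e ltry.
Qed.

(** The constants precede alpha. The corrector depends on alpha through the truncation level, but
    not on the probability space or the process. *)
Lemma lyapunov_step m : (m < p)%N -> 0 <= L2p ->
  exists C alpha0 : R, [/\ 0 <= C, 0 < alpha0 <= 1 &
  forall alpha, 0 < alpha < alpha0 -> exists vV : V -> X -> V,
  forall (dO : measure_display) (Omega : measurableType dO)
    (P : probability Omega R) (theta : nat -> Omega -> V) (x : nat -> Omega -> X)
    (xi : nat -> Omega -> V -> V),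
  sa_iterates P theta x xi K g alpha -> noise P theta x xi p thetas L2p Lxi ->
  let S k w := enorm (theta k w - thetas) ^+ (2 * m.+1) in
  let Ly k w := lyapunov m alpha (theta k w - thetas) (vV (theta k w) (x k w)) in
  (forall k w, `|Ly k w - S k w| <= S k w / 2 + C * alpha ^+ m.+2) /\
  forall k, P.-integrable setT (EFin \o S k) ->
    [/\ P.-integrable setT (EFin \o S k.+1), P.-integrable setT (EFin \o Ly k),
        P.-integrable setT (EFin \o Ly k.+1) &
    \int[P]_w Ly k.+1 w <= (1 - m.+1%:R * alpha * mu) * \int[P]_w Ly k w +
      C * alpha ^+ m.+2]].
Proof.
move=> mp L2p0.
have [Cv [Ch [Cl [Cv0 Ch0 Cl0 poisson]]]] :=
  vector_poisson.
pose l := 2 * L2p; have l0 : 0 <= l by rewrite mulr_ge0.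
pose n := m.+1%:R : R; have n0 : 0 < n by rewrite ltr0n.
(* Makes (1 + l) eta alpha equal to n alpha mu / 2. Of the contraction 2 n alpha mu acting on [S],
   3/2 n alpha mu remains, and 3/2 is the factor in the upper bound of [Ly] by [S]: what is left is
   n alpha mu acting on [Ly]. *)
pose eta := n * mu / (2 * (1 + l)).
have l10 : 0 < 1 + l by rewrite ltr_wpDr.
have eta0 : 0 < eta by rewrite divr_gt0 ?mulr_gt0.
have [C [a0 [C0 /andP[a00 a01] drift]]] :=
  @lyapunov_drift R d p m mu L1 Cv Ch eta mp L10 Cv0 Ch0 eta0.
have [C' C'0 dist] := @lyapunov_dist R d m Cv Cv0.
have nmu0 : 0 < n * mu by rewrite mulr_gt0.
exists (C' + (1 + l) * C), (Num.min a0 (n * mu)^-1); split.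
- by rewrite addr_ge0// mulr_ge0// ltW.
- by rewrite lt_min a00 invr_gt0 nmu0 ge_min a01.
move=> alpha /andP[al0]; rewrite lt_min => /andP[ala0 alnmu].
have al1 : alpha <= 1 by rewrite (le_trans (ltW ala0)).
(* With accuracy alpha, the Poisson error enters the drift at order alpha^2. *)
have [u hu] := poisson alpha al0.
rewrite /= in hu; case: hu => u1 u2 u3 u4 u5.
set vV := (fun t y => \row_i transition K t (u i t) y) in u2 u3.
exists vV => dO Omega P theta x xi sa ns S Ly.
have LyS k w : `|Ly k w - S k w| <= S k w / 2 + C' * alpha ^+ m.+2.
  by apply: dist; [rewrite al0|exact: u2].
have al2 : 0 <= alpha ^+ m.+2 by rewrite exprn_ge0// ltW.
have lC0 : 0 <= (1 + l) * C by rewrite mulr_ge0// ltW.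
split=> [k w|k iS].
  by apply: le_trans (LyS k w) _; rewrite lerD2l ler_wpM2r// lerDl.
have P1 : P setT = 1%E by exact: probability_setT.
have subG := history_sub theta x xi k (sa_theta_meas sa) (sa_x_meas sa) (sa_xi_meas sa).
have mth j := sa_theta_meas sa j; have mx j := sa_x_meas sa j.
have mu_ i j j' : measurable_fun setT (fun w => u i (theta j w) (x j' w)).
  have [h1 _ h3 _] := u5 i.
  exact: (evaluation_measurable cX _ _ _ _ _ (mth j) (mx j') Cl0 h3 h1).
have mv_ i j j' : measurable_fun setT
    (fun w => transition K (theta j w) (u i (theta j w)) (x j' w)).
  have [_ h2 _ h4] := u5 i.
  exact: (evaluation_measurable cX _ _ (fun t => transition K t (u i t)) _ _
    (mth j) (mx j') Cl0 h4 h2).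
have S0 j w : 0 <= S j w by rewrite exprn_ge0// enorm_ge0.
pose xc i j w : R := (theta j w - thetas) 0 i.
have mxcG i : measurable_fun [set: g_sigma_algebraType (history theta x xi k)]
    (xc i k : g_sigma_algebraType (history theta x xi k) -> R).
  by apply: coord_sub_measurable; exact: history_theta.
have mxc i j : measurable_fun setT (xc i j).
  exact/coord_sub_measurable/mth.
have mrG : measurable_fun [set: g_sigma_algebraType (history theta x xi k)]
    ((fun w => enorm (theta k w - thetas)) : g_sigma_algebraType (history theta x xi k) -> R).
  by apply: enorm_sub_measurable; exact: history_theta.
have mr j : measurable_fun setT (fun w => enorm (theta j w - thetas)).
  exact/enorm_sub_measurable/mth.
have mS j : measurable_fun setT (S j) by exact: measurable_funX.
have mLy j : measurable_fun setT (Ly j).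
  rewrite /Ly /lyapunov; apply: measurable_funD; first exact: measurable_funX.
  apply: measurable_funM.
    by apply: measurable_funM; [exact: measurable_cst|exact: measurable_funX].
  rewrite /edot; apply: measurable_sum => i; apply: measurable_funM; first exact: mxc.
  rewrite (_ : (fun _ => _) = fun w => transition K (theta j w) (u i (theta j w)) (x j w)).
    exact: mv_.
  by apply/funext => w; rewrite mxE.
pose z w := enorm (xi k.+1 w (theta k w)).
pose r w := enorm (theta k w - thetas).
have mxi i : measurable_fun setT (fun w => xi k.+1 w (theta k w) 0 i).
  by apply/measurable_EFinP; have [] := noise_centered_iterate ns k i.
have mz : measurable_fun setT z.
  apply: (@measurableT_comp _ _ _ _ _ _ (@Num.sqrt R)).
    apply: continuous_measurable_fun; exact: sqrt_continuous.
  by rewrite /edot; apply: measurable_sum => i; exact: measurable_funM.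
pose T w := (z w / (1 + r w)) ^+ (2 * p).
have z0 w : 0 <= z w by exact: enorm_ge0.
have r0 w : 0 <= r w by exact: enorm_ge0.
have b0 w : 0 < 1 + r w by rewrite ltr_wpDr.
have s0 w : 0 <= z w / (1 + r w) by rewrite divr_ge0// ltW.
have T0 w : 0 <= T w by rewrite exprn_ge0.
have mT : measurable_fun setT T.
  apply: measurable_funX; apply: measurable_funM => //.
  apply: (@measurableT_comp _ _ _ _ _ _
    (fun t : borel V => ((1 + enorm ((t : V) - thetas)) ^+ 1)^-1)); last exact: mth.
  by apply: continuous_borel_measurable; exact: inv_expr_enorm_continuous.
have NT (e c : R) : 0 <= e -> 0 <= c ->
    (\int[P]_w ((e * S k w + c) * T w)%:E <= \int[P]_w ((e * S k w + c) * l)%:E)%E.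
  move=> e0 c0; apply: (noise_weighted _ _ _ _ _ _ _ sa _ _ _ _ _ _ ns) => [|w].
    apply: measurable_funD; last exact: measurable_cst.
    by apply: measurable_funM; [exact: measurable_cst|exact: measurable_funX].
  by rewrite addr_ge0// mulr_ge0.
pose N w := 1 * S k w + 1.
have iN : P.-integrable setT (EFin \o N).
  have := integrableD measurableT iS (integrable_probability_cst _ _ P P1 1).
  by apply: eq_integrable => // w _ /=; rewrite /N mul1r.
have N0 w : 0 <= N w by rewrite addr_ge0// mul1r.
have iNT := integrable_weighted P N T l iN mT N0 T0 (NT 1 1 ler01 ler01).
(* [Z i] is a coordinate of the martingale increment, noise and Poisson part together; [W i] is its
   weight, measurable for the history. *)
pose Z i w := xi k.+1 w (theta k w) 0 i + (u i (theta k w) (x k.+1 w) -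
  transition K (theta k w) (u i (theta k w)) (x k w)).
pose W i w := enorm (theta k w - thetas) ^+ (2 * m) * xc i k w.
have iuv i : P.-integrable setT (EFin \o (fun w => u i (theta k w) (x k.+1 w) -
    transition K (theta k w) (u i (theta k w)) (x k w))).
  apply: (@bounded_le_integrable _ _ _ P P1 _ (Cv + Cv)); first exact: measurable_funB.
  move=> w; apply: le_trans (ler_normB _ _) _; apply: lerD.
    by have [] := u4 i (theta k w) (x k.+1 w).
  by have [] := u4 i (theta k w) (x k w).
have ixi i := noise_integrable P theta x xi k i ns.
have iZ i : P.-integrable setT (EFin \o Z i).
  by have := integrableD measurableT (ixi i) (iuv i); apply: eq_integrable.
have mW i : measurable_fun setT (W i).
  by apply: measurable_funM => //; exact: measurable_funX.
have mZ i : measurable_fun setT (Z i) by exact/measurable_EFinP/(measurable_int P).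
(* Both the noise and the bounded Poisson part of [Z] are at most a multiple of (1 + r)(1 + T), so
   the product with [W] is dominated by (1 + r)^(2m+2) (1 + T), whose integral [noise_weighted]
   controls. *)
have iWZ i : P.-integrable setT (EFin \o (fun w => W i w * Z i w)).
  pose B := 2 ^+ (2 * m.+1) * (1 + (Cv + Cv)).
  have : P.-integrable setT (EFin \o (fun w => B * (N w + N w * T w))).
    have iD : P.-integrable setT (EFin \o (fun w => N w + N w * T w)).
      by have := integrableD measurableT iN iNT; apply: eq_integrable.
    by have := integrableZl measurableT B iD; apply: eq_integrable.
  apply: le_integrable => //; first exact/measurable_EFinP/measurable_funM.
  move=> w _ /=; rewrite lee_fin; apply: le_trans _ (ler_norm _).
  have Wb : `|W i w| <= r w ^+ (2 * m).+1.
    have q0 : 0 <= r w ^+ (2 * m) by rewrite exprn_ge0.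
    rewrite /W normrM exprSr (ger0_norm q0).
    by apply: ler_wpM2l => //; exact: ler_coord_enorm.
  have Zb : `|Z i w| <= z w + (Cv + Cv).
    apply: le_trans (ler_normD _ _) _; apply: lerD; first exact: ler_coord_enorm.
    apply: le_trans (ler_normB _ _) _; apply: lerD.
      by have [] := u4 i (theta k w) (x k.+1 w).
    by have [] := u4 i (theta k w) (x k w).
  rewrite normrM; apply: le_trans (ler_pM (normr_ge0 _) (normr_ge0 _) Wb Zb) _.
  have sT : z w / (1 + r w) <= 1 + T w.
    rewrite -[leLHS]expr1; apply: expr_le1D => //.
    by rewrite muln_gt0 /= (leq_ltn_trans _ mp).
  have zE : z w = z w / (1 + r w) * (1 + r w) by rewrite divfK// gt_eqF.
  have bpow : (1 + r w) ^+ (2 * m.+1) <= 2 ^+ (2 * m.+1) * N w.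
    have := exprD_le 1 (r w) (2 * m.+1) ler01 (r0 w).
    by rewrite expr1n /N mul1r [S k w + 1]addrC.
  have bE : (1 + r w) ^+ (2 * m.+1) = (1 + r w) ^+ (2 * m).+1 * (1 + r w).
    by rewrite -exprSr mulnS.
  have rb : r w ^+ (2 * m).+1 <= (1 + r w) ^+ (2 * m).+1.
    by rewrite lerXn2r ?nnegrE ?(ltW (b0 w))// lerDr.
  have rm0 : 0 <= r w ^+ (2 * m).+1 by rewrite exprn_ge0.
  have bm0 : 0 <= (1 + r w) ^+ (2 * m).+1 by rewrite exprn_ge0// ltW.
  have zC : z w + (Cv + Cv) <= (1 + r w) * ((1 + (Cv + Cv)) * (1 + T w)).
    have CT : Cv + Cv <= (1 + r w) * ((Cv + Cv) * (1 + T w)).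
      have := mulr_ge0 (addr_ge0 Cv0 Cv0) (T0 w).
      have := mulr_ge0 (r0 w) (mulr_ge0 (addr_ge0 Cv0 Cv0) (addr_ge0 ler01 (T0 w))).
      by lra.
    have zT : z w <= (1 + r w) * (1 + T w).
      by rewrite {1}zE mulrC ler_pM2l.
    by lra.
  apply: le_trans (ler_pM rm0 (addr_ge0 (z0 w) (addr_ge0 Cv0 Cv0)) rb zC) _.
  rewrite [leLHS]mulrA -bE.
  have -> : B * (N w + N w * T w) =
      2 ^+ (2 * m.+1) * N w * ((1 + (Cv + Cv)) * (1 + T w)) by rewrite /B; ring.
  by rewrite ler_wpM2r// mulr_ge0 ?addr_ge0.
have mean0 i : \int[P]_w (W i w * Z i w) = 0.
  apply: (@weighted_integral_eq0 _ _ _ P _ subG (Z i) (W i) (iZ i) _ _ (iWZ i)).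
    move=> B GB; have mB := subG _ GB.
    rewrite /Z RintegralD//; [|exact: integrableS (ixi i)|exact: integrableS (iuv i)].
    have [h1 h2 h3 h4] := u5 i.
    rewrite (conditional_transition _ _ _ _ _ _ _ cX sa k (u i) Ch Cl Cv Cl0 h3 h1)//.
    - have [_ _ _ hB] := noise_centered_iterate ns k i.
      have := hB B; rewrite -history_idem => /(_ GB) h.
      by rewrite addr0 /Rintegral -h integral_cst// mul0e.
    - by move=> t y; have [] := u4 i t y.
    - by move=> w; have [] := u4 i (theta k w) (x k w).
  by apply: measurable_funM => //; exact: measurable_funX.
have path w : Ly k.+1 w <= Ly k w - (2 * m.+1)%:R * alpha * mu * S k w +
    (2 * m.+1)%:R * alpha * (\sum_i W i w * Z i w) +
    (eta * alpha * S k w + C * alpha ^+ m.+2) * (1 + T w).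
  have E : theta k.+1 w - thetas = (theta k w - thetas) +
      alpha *: (g (theta k w) (x k.+1 w) + xi k.+1 w (theta k w)).
    by rewrite (sa_rec sa) addrAC.
  have := drift alpha (theta k w - thetas) (g (theta k w) (x k.+1 w))
    (xi k.+1 w (theta k w)) (gbar (theta k w)) (\row_i u i (theta k w) (x k.+1 w))
    (vV (theta k w) (x k w)) (vV (theta k w) (x k.+1 w))
    (vV (theta k.+1 w) (x k.+1 w)).
  rewrite -E.
  have -> : enorm (theta k w - thetas) ^+ (2 * m) * edot (theta k w - thetas)
      (xi k.+1 w (theta k w) + \row_i u i (theta k w) (x k.+1 w) - vV (theta k w) (x k w))
      = \sum_i W i w * Z i w.
    rewrite /edot mulr_sumr; apply: eq_bigr => i _.
    by rewrite /W /Z /xc !mxE; ring.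
  apply.
  - by rewrite al0 ala0.
  - by have := mono.2 (theta k w) thetas; rewrite root subr0.
  - exact: reg_growth reg _ _.
  - exact: u1.
  - exact: u2.
  - have -> : alpha *: (g (theta k w) (x k.+1 w) + xi k.+1 w (theta k w)) =
        theta k.+1 w - theta k w by rewrite (sa_rec sa) addrAC subrr add0r.
    exact: u3.
have e0 : 0 <= eta * alpha by rewrite mulr_ge0// ltW.
have c0 : 0 <= C * alpha ^+ m.+2 by rewrite mulr_ge0.
have [iS' iV iV' le] := drift_expectation P d (S k) (S k.+1) (Ly k) (Ly k.+1) T
  (fun i w => W i w * Z i w) _ _ _ l _ _ iS (S0 k) (S0 k.+1) (mS _) (mLy _) (mLy _)
  mT T0 (LyS k) (LyS k.+1) iWZ mean0 e0 c0 (NT _ _ e0 c0) path.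
split => //; apply: le_trans le _.
have LyI : \int[P]_w Ly k w <= 3 / 2 * \int[P]_w S k w + C' * alpha ^+ m.+2.
  have iS32 : P.-integrable setT (EFin \o (fun w => 3 / 2 * S k w)).
    by have := integrableZl measurableT (3 / 2) iS; apply: eq_integrable.
  have icst := integrable_probability_cst _ _ P P1 (C' * alpha ^+ m.+2).
  rewrite -(Rintegral_probability_cst _ _ P P1 (C' * alpha ^+ m.+2)).
  rewrite -RintegralZl// -RintegralD//; apply: le_Rintegral => //.
    by have := integrableD measurableT iS32 icst; apply: eq_integrable.
  by move=> w _ /=; have := LyS k w; rewrite ler_norml => /andP[_]; lra.
have el : (1 + l) * (eta * alpha) = n * alpha * mu / 2.
  by rewrite /eta; field; rewrite gt_eqF.
have -> : (2 * m.+1)%:R = 2 * n by rewrite natrM.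
have na1 : n * alpha * mu <= 1.
  have := ltW alnmu; rewrite -(ler_pM2l nmu0) mulfV ?gt_eqF//; lra.
have na0 : 0 <= n * alpha * mu by rewrite !mulr_ge0// ltW.
have h1 := ler_wpM2l na0 LyI.
have C'a : 0 <= C' * alpha ^+ m.+2 by rewrite mulr_ge0.
have h2 : n * alpha * mu * (C' * alpha ^+ m.+2) <= C' * alpha ^+ m.+2.
  by rewrite ler_piMl.
rewrite mulrDr mulrA el -/n; lra.
Qed.

End assembly.

(** * Iterating the drift inequality *)

Theorem theorem3p1 (R : realType) (d : nat) (X : pointedMetricType R)
    (K : 'rV[R]_d -> R.-pker (borel X) ~> (borel X))
    (pi_ : 'rV[R]_d -> probability (borel X) R)
    (g : 'rV[R]_d -> X -> 'rV[R]_d) (thetas : 'rV[R]_d)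
    (L1 mu rho LP L2p Lxi : R) (p : nat) :
  (forall theta, unique_invariant (K theta) (pi_ theta)) ->
  measurable_fun [set: borel 'rV[R]_d * borel X]
    ((fun z => g z.1 z.2) : borel 'rV[R]_d * borel X -> borel 'rV[R]_d) ->
  mean_field pi_ g thetas = 0 ->
  regularity g (mean_field pi_ g) thetas L1 ->
  monotonicity (mean_field pi_ g) mu ->
  kernel_contraction K rho LP ->
  (1 <= p)%N ->
  forall n : nat, (1 <= n <= p)%N ->
  exists C1 C2 alphan : R,
    [/\ 0 < C1, 0 < C2, 0 < alphan < 1 &
    forall alpha : R, 0 < alpha < alphan ->
    forall (dO : measure_display) (Omega : measurableType dO)
      (P : probability Omega R) (theta : nat -> Omega -> 'rV[R]_d)
      (x : nat -> Omega -> X)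
      (xi : nat -> Omega -> 'rV[R]_d -> 'rV[R]_d),
    sa_iterates P theta x xi K g alpha ->
    noise P theta x xi p thetas L2p Lxi ->
    forall k : nat,
    ('E_P[(fun w => enorm (theta k w - thetas) ^+ (2 * n))%R]
     <= ((1 - n%:R * alpha * mu) ^+ k * C1)%:E *
          'E_P[(fun w => enorm (theta 0%N w - thetas) ^+ (2 * n))%R]
        + (C2 * alpha ^+ n)%:E)%E].
Proof.
move=> inv mg root reg mono ker p1 [//|m] /andP[_ mp].
have mu0 : 0 < mu by case: mono.
have half : 0 < (2^-1 : R) < 1 by rewrite invr_gt0 invf_lt1 ?ltr1n ?ltr0n.
(* The constants are chosen before the noise. If [L2p] is not positive, no process satisfies [noise]
   and any constants do. *)
have [L2p0|L2p0] := ltrP 0 L2p; last first.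
  exists 1, 1, 2^-1; split => // alpha _ dO Omega P theta x xi _ ns.
  by have := noise_L2p_gt0 ns; rewrite ltNge L2p0.
have [C [alpha0 [C0 /andP[a00 a01] step]]] := lyapunov_step K pi_ g thetas L1 mu rho LP
  L2p Lxi p inv root reg mono ker m mp (ltW L2p0).
pose n : R := m.+1%:R; have n0 : 0 < n by rewrite ltr0n.
have nmu0 : 0 < n * mu by rewrite mulr_gt0.
have D0 : 0 <= C / (n * mu) by rewrite divr_ge0// ltW.
(* 3 is 2 times 3/2, the comparison of [S] with [Ly] at times k and 0. The comparison errors total
   at most 6c, and alpha < 1/2 gives 2c <= C alpha^n; [C / (n * mu)] sums the drift errors, and 1
   ensures positivity. The last bound on alpha keeps the rate [q] positive. *)
exists 3, (4 * C + 2 * (C / (n * mu)) + 1),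
  (Num.min alpha0 (Num.min 2^-1 (2 * (n * mu))^-1)); split => //.
- by rewrite ltr_wpDl// addr_ge0// mulr_ge0.
- rewrite !lt_min a00 invr_gt0 ltr0n invr_gt0 mulr_gt0//=.
  by rewrite !gt_min; case/andP: half => _ ->; rewrite orbT.
move=> alpha /andP[al0]; rewrite !lt_min => /and3P[ala0 alh alnmu].
move=> dO Omega P theta x xi sa ns k.
have [vV hV] := step alpha (ltac:(by rewrite al0 ala0)).
have [VS rec] := hV dO Omega P theta x xi sa ns => {hV step}.
pose S j w := enorm (theta j w - thetas) ^+ (2 * m.+1).
pose Ly j w := lyapunov m alpha (theta j w - thetas) (vV (theta j w) (x j w)).
pose c := C * alpha ^+ m.+2.
have {}VS j w : `|Ly j w - S j w| <= S j w / 2 + c := VS j w.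
have S0 j w : 0 <= S j w by rewrite exprn_ge0// enorm_ge0.
have na2 : n * alpha * mu <= 2^-1.
  have := ltW alnmu; rewrite -(ler_pM2l nmu0) invfM [n * mu * (_ * _)]mulrCA.
  by rewrite mulfV ?gt_eqF// mulr1; lra.
have na0 : 0 < n * alpha * mu by rewrite !mulr_gt0.
set q := 1 - n * alpha * mu.
have q01 : 0 < q < 1 by rewrite /q; apply/andP; split; lra.
have [q0 q1] := andP q01.
have P1 : P setT = 1%E by exact: probability_setT.
have mS j : measurable_fun setT (S j).
  exact/measurable_funX/enorm_sub_measurable/(sa_theta_meas sa).
have ES j : ('E_P[S j] = \int[P]_w (S j w)%:E)%E by rewrite unlock.
(* If the initial moment is infinite, so is the right-hand side, because its coefficient is
   positive. *)
have [inf|fin] := eqVneq (\int[P]_w (S 0%N w)%:E)%E +oo%E.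
  rewrite [X in (_ <= _ * X + _)%E](ES 0%N) inf gt0_muley; last first.
    by rewrite lte_fin; apply: (@mulr_gt0 _ (q ^+ k)); rewrite ?exprn_gt0.
  by rewrite addye// leey.
have iS0 : P.-integrable setT (EFin \o S 0%N).
  apply/integrableP; split; first exact/measurable_EFinP.
  under eq_integral => w _ do rewrite /= ger0_norm//.
  by rewrite ltey.
have iS j : P.-integrable setT (EFin \o S j).
  by elim: j => // j IH; case: (rec j IH).
have iL j : P.-integrable setT (EFin \o Ly j) by case: (rec j (iS j)).
have E j : ('E_P[S j] = (\int[P]_w S j w)%R%:E)%E.
  by rewrite ES /Rintegral fineK//; exact: (integrable_fin_num measurableT (iS j)).
rewrite [X in (X <= _)%E](E k) [X in (_ <= _ * X + _)%E](E 0%N) -EFinM -EFinD lee_fin.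
have c0 : 0 <= c by rewrite mulr_ge0// exprn_ge0// ltW.
have icst r : P.-integrable setT (EFin \o cst r) by exact: integrable_probability_cst.
have scale (r : R) (f : Omega -> R) : P.-integrable setT (EFin \o f) ->
    P.-integrable setT (EFin \o (fun w => r * f w)).
  by move=> i; have := integrableZl measurableT r i; apply: eq_integrable.
have add (f h : Omega -> R) : P.-integrable setT (EFin \o f) ->
    P.-integrable setT (EFin \o h) -> P.-integrable setT (EFin \o (fun w => f w + h w)).
  by move=> i i'; have := integrableD measurableT i i'; apply: eq_integrable.
have lin (r : R) (f : Omega -> R) : P.-integrable setT (EFin \o f) ->
    \int[P]_w (r * f w + cst (2 * c) w) = r * \int[P]_w f w + 2 * c.
  move=> i; have i1 := scale r _ i; have i2 := icst (2 * c).
  by rewrite RintegralD// RintegralZl// Rintegral_probability_cst.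
have upper : \int[P]_w S k w <= 2 * \int[P]_w Ly k w + 2 * c.
  rewrite -lin//; apply: le_Rintegral => //; first by apply: add => //; exact: scale.
  move=> w _ /=; have := VS k w; rewrite ler_norml => /andP[]; lra.
have lower : \int[P]_w Ly 0%N w <= 3 / 2 * \int[P]_w S 0%N w + 2 * c.
  rewrite -lin//; apply: le_Rintegral => //; first by apply: add => //; exact: scale.
  move=> w _ /=; have := VS 0%N w; rewrite ler_norml => /andP[]; lra.
have := @affine_recursion R q c (fun j => \int[P]_w Ly j w).
rewrite (ltW q0) q1 c0 => /(_ isT isT) rec'.
have {rec'} ub := rec' (fun j => let: And4 _ _ _ h := rec j (iS j) in h) k.
(* Summing errors of order alpha^(n+1) against the gap 1 - q = n alpha mu costs one power of
   alpha. *)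
have cq : c / (1 - q) = C / (n * mu) * alpha ^+ m.+1.
  rewrite /c (_ : 1 - q = n * mu * alpha); last by rewrite /q; ring.
  rewrite [alpha ^+ m.+2]exprSr.
  have y0 : n * mu != 0 by rewrite gt_eqF.
  have x0 : alpha != 0 by rewrite gt_eqF.
  move: (n * mu) (alpha ^+ m.+1) y0 => y A y0; field.
  by rewrite x0 y0.
rewrite cq in ub.
have qk1 : q ^+ k <= 1 by rewrite exprn_ile1// ltW.
have qk0 : 0 <= q ^+ k by rewrite exprn_ge0// ltW.
have am0 : 0 <= alpha ^+ m.+1 by rewrite exprn_ge0// ltW.
have cam : 2 * c <= C * alpha ^+ m.+1.
  have -> : 2 * c = 2 * alpha * (C * alpha ^+ m.+1).
    by rewrite /c exprS; move: (alpha ^+ m.+1) => A; ring.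
  by rewrite ler_piMl ?mulr_ge0//; lra.
have CA0 : 0 <= C * alpha ^+ m.+1 by rewrite mulr_ge0.
have ub' := ler_wpM2l qk0 lower.
have qc : q ^+ k * (2 * c) <= 2 * c by rewrite ler_piMl// mulr_ge0.
rewrite /= in ub.
rewrite -/n -/q; move: upper ub ub' qc cam CA0 am0 c0.
move: (q ^+ k) (alpha ^+ m.+1) (C / (n * mu)) (c).
move: (\int[P]_w S k w) (\int[P]_w S 0%N w) (\int[P]_w Ly k w) (\int[P]_w Ly 0%N w).
by move=> *; lra.
Qed.
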